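(* Let $t>d/2$, $q\in\mathbb N$, and let $u^\dagger$ be a continuous mean-zero function on $\mathbb T^d$ with absolutely summable Fourier coefficients $\hat u(m)$. Let $\hat u(m,t,q)$ denote the Fourier coefficients of $u(\cdot,t,q)$. Then $\hat u(0,t,q)=0$ and, for $m\in\mathbb Z^d\setminus\{0\}$, $$\hat u(m,t,q)=|m|^{-2t}\,\frac{(T_q\hat u)(m)}{M_q^t(m)}.$$
   Context: $\mathbb T^d=[0,1]^d$ periodic; $\phi_m(x)=e^{2\pi i\langle m,x\rangle}$; $\hat v(m)=\int_{\mathbb T^d}v\overline{\phi_m}$; $\|v\|_t^2=\sum_m(4\pi^2|m|^2)^t|\hat v(m)|^2$. For $t>d/2$, $K_t(x,y)=\sum_{m\neq0}(4\pi^2|m|^2)^{-t}\phi_m(x)\overline{\phi_m(y)}$. $J_q=\{0,\dots,2^q-1\}^d$, $x_j=j2^{-q}$, $\mathcal X_q=\{x_j:j\in J_q\}$, $K(t,q)=(K_t(x_i,x_j))_{i,j\in J_q}$, and $u(\cdot,t,q)=K_t(\cdot,\mathcal X_q)K(t,q)^{-1}u^\dagger(\mathcal X_q)$ (the minimal $\|\cdot\|_t$-norm interpolant of $u^\dagger$ on $\mathcal X_q$). Periodization: $(T_qg)(m)=\sum_{\beta\in\mathbb Z^d}g(m+2^q\beta)$. Define the $2^q$-periodic function $M_q^t(m)=\sum_{\beta\in\mathbb Z^d\setminus\{0\}}|2^q\beta|^{-2t}$ if $m\in2^q\mathbb Z^d$, and $M_q^t(m)=\sum_{\beta\in\mathbb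 Z^d}|m+2^q\beta|^{-2t}$ otherwise. *)

(* Defs.v *)
From HB Require Import structures.
From mathcomp Require Import all_boot all_order all_algebra.
From mathcomp Require Import all_classical all_reals all_analysis.
From mathcomp Require Import complex.
Set Implicit Arguments. Unset Strict Implicit. Unset Printing Implicit Defensive.
Import Order.TTheory GRing.Theory Num.Theory.
Import numFieldNormedType.Exports.
Local Open Scope ring_scope.
Local Open Scope complex_scope.

Section Torus.
Variable R : realType.

(* points of R^d (the torus T^d = [0,1]^d torus_periodic is handled through
   1-torus_periodic functions and integration over [0,1]^d) *)
Definition pt (d : nat) := 'rV[R]_d.
Definition lat (d : nat) := 'I_d -> int.

Definition latzero d (m : lat d) : bool := [forall i, m i == 0%Z].

Definition dotp d (m : lat d) (x : pt d) : R := \sum_(i < d) (m i)%:~R * x ord0 i.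
Definition norm2 d (m : lat d) : R := \sum_(i < d) ((m i)%:~R) ^+ 2.

Definition cconj (z : R[i]) : R[i] := Complex (complex.Re z) (- complex.Im z).
Definition cabs (z : R[i]) : R := Num.sqrt (complex.Re z ^+ 2 + complex.Im z ^+ 2).

Definition phi d (m : lat d) (x : pt d) : R[i] :=
  Complex (cos (2 * pi * dotp m x)) (sin (2 * pi * dotp m x)).

Fixpoint cint_nat (n : nat) (F : (nat -> R) -> R) : R :=
  match n with
  | 0 => F (fun _ => 0)
  | n'.+1 => Rintegral (@lebesgue_measure R) `[0%R, 1%R]%classic
      (fun s => cint_nat n' (fun y => F (fun k => if k == n' then s else y k)))
  end.

Definition cube_int d (F : pt d -> R) : R :=
  cint_nat d (fun y => F (\row_(i < d) y (nat_of_ord i))).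

Definition fourier d (v : pt d -> R[i]) (m : lat d) : R[i] :=
  Complex (cube_int (fun x => complex.Re (v x * cconj (phi m x))))
          (cube_int (fun x => complex.Im (v x * cconj (phi m x)))).

(* sums over Z^d: limits of the partial sums over the boxes [-N,N]^d
   (these agree with the sum for absolutely summable families) *)
Definition boxpt d N (k : {ffun 'I_d -> 'I_(2 * N).+1}) : lat d :=
  fun i => (nat_of_ord (k i))%:Z - N%:Z.
Definition boxsumR d (f : lat d -> R) (N : nat) : R :=
  \sum_(k : {ffun 'I_d -> 'I_(2 * N).+1}) f (boxpt k).
Definition zsumR d (f : lat d -> R) : R := limn (boxsumR f).
Definition zsum d (f : lat d -> R[i]) : R[i] :=
  Complex (zsumR (fun m => complex.Re (f m))) (zsumR (fun m => complex.Im (f m))).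

Definition abs_summable d (f : lat d -> R[i]) : Prop :=
  exists B : R, forall N, boxsumR (fun m => cabs (f m)) N <= B.

Definition Kt d (t : R) (x y : pt d) : R[i] :=
  zsum (fun m : lat d => if latzero m then 0
        else (powR (4 * pi ^+ 2 * norm2 m) (- t))%:C * phi m x * cconj (phi m y)).

Definition Jq d q := {ffun 'I_d -> 'I_(2 ^ q)}.
Definition gridpt d q (j : Jq d q) : pt d :=
  \row_(i < d) ((nat_of_ord (j i))%:R / (2 ^ q)%:R).
Definition nJ d q := #|{: Jq d q}|.
Definition gridJ d q (a : 'I_(nJ d q)) : pt d := gridpt (enum_val a).

Definition Kmat d (t : R) q : 'M[R[i]]_(nJ d q) :=
  \matrix_(a, b) Kt t (gridJ a) (gridJ b).

Definition uinterp d (t : R) q (u : pt d -> R[i]) (x : pt d) : R[i] :=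
  let c := invmx (Kmat d t q) *m \col_(b < nJ d q) u (gridJ b) in
  \sum_(a < nJ d q) Kt t x (gridJ a) * c a ord0.

Definition latshift d q (m beta : lat d) : lat d :=
  fun i => (m i + (2 ^ q)%:Z * beta i)%R.
Definition Tq d q (g : lat d -> R[i]) (m : lat d) : R[i] :=
  zsum (fun beta => g (latshift q m beta)).

Definition in_lattice_q d q (m : lat d) : bool :=
  [forall i, ((2 ^ q)%:Z %| m i)%Z].

Definition Mqt d q (t : R) (m : lat d) : R :=
  if in_lattice_q q m then
    zsumR (fun beta : lat d => if latzero beta then 0
           else powR (norm2 (latshift q (fun _ => 0%Z) beta)) (- t))
  else zsumR (fun beta : lat d => powR (norm2 (latshift q m beta)) (- t)).

Definition torus_periodic d (u : pt d -> R[i]) : Prop :=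
  forall (x : pt d) (i : 'I_d), u (x + \row_(j < d) (j == i)%:R) = u x.

End Torus.

(* Main.v *)
(** With [kappa m = (4 pi^2 |m|^2)^(-t)] ([0] at [m = 0]) and [n = 2^q], the
    characters [phi_m] with [m] in a fixed class modulo [n] agree on the grid.
    Grouping the series of [K_t] and of [u] by classes therefore gives
    [K(t,q) = Phi diag(L) Phi^*] and [u(X_q) = Phi tau], where
    [Phi = (phi_k(x_j))] satisfies [Phi^* Phi = n^d], [L_k] is the periodization of
    [kappa] (a positive multiple of [M_q^t(k)]) and [tau_k = (T_q uhat)(k)].
    Hence the coefficients [c = K^-1 u(X_q)] satisfy [L_k (Phi^* c)_k = tau_k], while
    the [m]-th Fourier coefficient of [sum_a c_a K_t(., x_a)] is
    [kappa(m) (Phi^* c)_k] for [m] congruent to [k].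

    That [u] equals its Fourier series follows from Korovkin's argument: a
    continuous periodic [f] satisfies
    [|f(x0) - f(y)| <= e + C sum_i (1 - cos 2 pi (y_i - x0_i))], and the right-hand
    side is integrated explicitly against the (unnormalized) Fejér kernel. *)

Require Import Defs.
From HB Require Import structures.
From mathcomp Require Import all_boot all_order all_algebra.
From mathcomp Require Import all_classical all_reals all_analysis.
From mathcomp Require Import complex.
From mathcomp Require Import zify ring lra.
Import Order.TTheory GRing.Theory Num.Theory.
Import numFieldNormedType.Exports.
Local Open Scope ring_scope.
Local Open Scope complex_scope.
Set Implicit Arguments. Unset Strict Implicit. Unset Printing Implicit Defensive.

(** * Absolutely convergent sums over the lattice *)

(** Lattice sums are limits over boxes, and neither a translation nor a splitting into classes
    modulo 2^q maps boxes to boxes. Every rearrangement therefore rests on one estimate: the sum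
    over any finite injective family containing the box of radius N differs from the full sum by at
    most the tail, outside that box, of a dominating series.

    Integrals over the cube are iterated one-dimensional integrals. Only their linearity, their
    monotonicity and the integral of a phase-shifted cosine are used, so the order of integration is
    never exchanged.

    The Fejér kernel is kept as a squared modulus, which makes its positivity visible, and its
    integrals become counts of pairs k, l with k - l equal to 0 or to plus or minus a unit vector.
    With M = N + 1, a lower count M^d - M^(d-1) is enough: the relative error 1/M can be made small
    because C is fixed before N.

    In dimension 0 the kernel is zero and its matrix is singular. Positivity of L therefore carries
    the condition 0 < d, which any nonzero m supplies. *)

Lemma sum_subrange_dist (R : realType) (T : Type) (I J : finType)
    (a : I -> T) (b : J -> T) (f G : T -> R) :
  injective a -> injective b -> (forall i, exists j, b j = a i) ->
  (forall x, `|f x| <= G x) ->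
  `|\sum_j f (b j) - \sum_i f (a i)| <= \sum_j G (b j) - \sum_i G (a i).
Proof.
move=> inja injb sub dom.
have [h hE] := choice sub.
have injh : injective h.
  by move=> i i' e; apply: inja; rewrite -!hE e.
(* Removing the image of [h] leaves the same index set for f and for G, so the two differences can
   be compared term by term. *)
have split (g : T -> R) :
    \sum_j g (b j) - \sum_i g (a i) =
    \sum_(j | j \notin [set h i | i in I]) g (b j).
  rewrite (bigID (fun j => j \in [set h i | i in I])) /= big_imset /=; last first.
    by move=> i i' _ _; apply: injh.
  rewrite (eq_bigr (fun i => g (a i))); last by move=> i _; rewrite hE.
  by rewrite addrAC subrr add0r.
rewrite !split; apply: (le_trans (ler_norm_sum _ _ _)).
exact: ler_sum.
Qed.

Section LatticeSums.
Local Open Scope classical_set_scope.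
Variables (R : realType) (d : nat).
Implicit Types (f G : lat d -> R) (m : lat d) (N : nat).

Lemma boxpt_inj N : injective (@boxpt d N).
Proof.
move=> k k' e; apply/ffunP => i; apply/val_inj => /=.
have := congr1 (fun m => m i) e; rewrite /boxpt; lia.
Qed.

Lemma boxpt_le N k i : (`|@boxpt d N k i| <= N)%N.
Proof. rewrite /boxpt; have := ltn_ord (k i); lia. Qed.

Lemma mem_box N m : (forall i, `|m i| <= N)%N -> exists k, @boxpt d N k = m.
Proof.
move=> h; exists [ffun i => inord (absz (m i + N%:Z))].
apply/funext => i; rewrite /boxpt ffunE inordK; have := h i; lia.
Qed.

Lemma fin_subbox (I : finType) (a : I -> lat d) :
  exists N, forall i, exists k, @boxpt d N k = a i.
Proof.
exists (\max_i \max_j `|a i j|)%N => i; apply: mem_box => j.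
exact: (leq_trans (leq_bigmax j) (leq_bigmax i)).
Qed.

Lemma subbox N N' : (N <= N')%N -> forall k, exists k', @boxpt d N' k' = @boxpt d N k.
Proof.
by move=> le k; apply: mem_box => i; apply: leq_trans le; apply: boxpt_le.
Qed.

Definition box_bounded G := exists B : R, forall N, boxsumR G N <= B.

(** A separate majorant lets the modulus of a complex family serve for its real and its imaginary
    part. *)
Definition dominated f G := (forall m, `|f m| <= G m) /\ box_bounded G.

Lemma dominated_ge0 f G : dominated f G -> forall m, 0 <= G m.
Proof. by move=> [h _] m; apply: le_trans (h m). Qed.

(** Taking f = G in [sum_subrange_dist], the difference of the two box sums bounds an absolute
    value, hence is nonnegative. *)
Lemma boxsum_homo G : (forall m, 0 <= G m) -> {homo boxsumR G : N N' / (N <= N')%N >-> N <= N'}.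
Proof.
move=> G0 N N' le; rewrite -subr_ge0.
have dom m : `|G m| <= G m by rewrite ger0_norm.
exact: le_trans (normr_ge0 _)
  (sum_subrange_dist (@boxpt_inj N) (@boxpt_inj N') (subbox le) dom).
Qed.

Lemma boxsum_cvg_ge0 G : (forall m, 0 <= G m) -> box_bounded G ->
  boxsumR G @ \oo --> zsumR G.
Proof.
move=> G0 [B hB].
apply: (nondecreasing_is_cvgn (boxsum_homo G0)).
by exists B => _ [N _ <-].
Qed.

(** Writing f = (f + G) - G reduces to two nonnegative families, whose box sums are monotone and
    bounded. *)
Lemma boxsum_cvg f G : dominated f G -> boxsumR f @ \oo --> zsumR f.
Proof.
move=> h; have G0 := dominated_ge0 h; have [dom [B hB]] := h.
have fG0 m : 0 <= f m + G m.
  by have := dom m; rewrite ler_norml => /andP[]; rewrite addrC -subr_ge0 opprK addrC.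
have addE N : boxsumR (fun m => f m + G m) N = boxsumR f N + boxsumR G N.
  by rewrite /boxsumR big_split.
have fGb : box_bounded (fun m => f m + G m).
  exists (B + B) => N; rewrite addE lerD //; apply: le_trans (hB N).
  by apply: ler_sum => k _; apply: le_trans (dom _); apply: ler_norm.
have c1 := boxsum_cvg_ge0 fG0 fGb.
have c2 := boxsum_cvg_ge0 G0 (ex_intro _ B hB).
have E : boxsumR f = boxsumR (fun m => f m + G m) - boxsumR G.
  by apply/funext => N; rewrite !fctE addE addrK.
have := cvgB c1 c2; rewrite -E => /(_ _) c.
by rewrite /zsumR (cvg_lim _ c).
Qed.

Definition tail G N : R := zsumR G - boxsumR G N.

Lemma tail_cvg0 G : (forall m, 0 <= G m) -> box_bounded G -> tail G @ \oo --> (0 : R).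
Proof.
move=> G0 bG; rewrite -[X in _ --> X](subrr (zsumR G)).
by apply: cvgB; [exact: cvg_cst | exact: boxsum_cvg_ge0].
Qed.

Lemma boxsum_le_zsum G N : (forall m, 0 <= G m) -> box_bounded G -> boxsumR G N <= zsumR G.
Proof.
move=> G0 bG; apply: nondecreasing_cvgn_le; first exact: boxsum_homo.
by apply: cvgP; apply: boxsum_cvg_ge0.
Qed.

(** A large box n contains the family, so the partial sums of f differ by at most the G-mass of the
    box outside the family. That mass is at most [tail G N] because the family contains the box N;
    then n tends to infinity. *)
Lemma zsum_dist (I : finType) (a : I -> lat d) f G N : dominated f G ->
  injective a -> (forall k, exists i, a i = @boxpt d N k) ->
  `|zsumR f - \sum_i f (a i)| <= tail G N.
Proof.
move=> h inja sub; have G0 := dominated_ge0 h; have [dom bG] := h.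
have [N0 hN0] := fin_subbox a.
have c : (fun n => `|boxsumR f n - \sum_i f (a i)|) @ \oo --> `|zsumR f - \sum_i f (a i)|.
  by apply: cvg_norm; apply: cvgB; [exact: boxsum_cvg h | exact: cvg_cst].
rewrite -(cvg_lim _ c) //; apply: limr_le; first exact: cvgP c.
near=> n.
have le : (N0 <= n)%N by near: n; exists N0.
apply: (@le_trans _ _ (boxsumR G n - \sum_i G (a i))).
  apply: sum_subrange_dist => // [|i]; first exact: boxpt_inj.
  by have [k <-] := hN0 i; apply: subbox.
rewrite lerB ?boxsum_le_zsum //.
rewrite -subr_ge0.
have domG m : `|G m| <= G m by rewrite ger0_norm.
exact: le_trans (normr_ge0 _) (sum_subrange_dist (@boxpt_inj N) inja sub domG).
Unshelve. all: by end_near.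
Qed.

Lemma boxsum_dist f G N : dominated f G -> `|zsumR f - boxsumR f N| <= tail G N.
Proof. by move=> h; apply: zsum_dist => // [|k]; [exact: boxpt_inj | exists k]. Qed.

Lemma zsum_cvg_fin (I : nat -> finType) (a : forall N, I N -> lat d) f G :
  dominated f G -> (forall N, injective (a N)) ->
  (forall N k, exists i, a N i = @boxpt d N k) ->
  (fun N => \sum_i f (a N i)) @ \oo --> zsumR f.
Proof.
move=> h inja sub; have [_ bG] := h.
apply/cvgrPdist_le => e e0.
have /cvgrPdist_le/(_ e e0) := tail_cvg0 (dominated_ge0 h) bG.
apply: filterS => N; rewrite sub0r normrN => le.
by apply: le_trans (zsum_dist h (inja N) (sub N)) (le_trans (ler_norm _) le).
Qed.

Lemma bounded_comp_inj G (s : lat d -> lat d) : injective s ->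
  (forall m, 0 <= G m) -> box_bounded G -> box_bounded (G \o s).
Proof.
move=> injs G0 [B hB]; exists B => N.
have [N' hN'] := fin_subbox (fun k => s (@boxpt d N k)).
apply: le_trans (hB N'); rewrite -subr_ge0.
have dom m : `|G m| <= G m by rewrite ger0_norm.
have inj : injective (fun k => s (@boxpt d N k)) by move=> k k' /injs/boxpt_inj.
exact: le_trans (normr_ge0 _) (sum_subrange_dist inj (@boxpt_inj N') hN' dom).
Qed.

Lemma dominated_comp_inj f G (s : lat d -> lat d) : injective s ->
  dominated f G -> dominated (f \o s) (G \o s).
Proof.
move=> injs h; split; first by move=> m; apply: (h.1).
by apply: bounded_comp_inj => //; [exact: dominated_ge0 h | exact: (h.2)].
Qed.

Definition latadd (m m' : lat d) : lat d := fun i => m i + m' i.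
Definition latopp m : lat d := fun i => - m i.

Lemma zsum_shift f G (g : lat d) : dominated f G ->
  zsumR (fun b => f (latadd b g)) = zsumR f.
Proof.
move=> h.
have injs : injective (fun b => latadd b g).
  by move=> b b' e; apply/funext => i; have := congr1 (fun m => m i) e; rewrite /latadd; lia.
have [L hL] := fin_subbox (fun _ : unit => g).
have gL i : (`|g i| <= L)%N by have [k <-] := hL tt; apply: boxpt_le.
(* Enlarging the radius by L makes the translated box contain the centred box of radius N. The same
   sums are box sums of the shifted family, so both limits are available. *)
pose a N (k : {ffun 'I_d -> 'I_(2 * (N + L)).+1}) := latadd (boxpt k) g.
have c1 : (fun N => \sum_k f (@a N k)) @ \oo --> zsumR f.
  apply: (zsum_cvg_fin (a := a) h) => [N k k' /injs/boxpt_inj//|N k].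
  have [|k' hk'] := @mem_box (N + L) (latadd (boxpt k) (latopp g)).
    move=> i; rewrite /latadd /latopp.
    have := boxpt_le k i; have := gL i; lia.
  by exists k'; rewrite /a hk'; apply/funext => i; rewrite /latadd /latopp; lia.
have c2 := boxsum_cvg (dominated_comp_inj injs h).
have c3 : (fun N => \sum_k f (@a N k)) @ \oo --> zsumR (fun b => f (latadd b g)).
  by move: c2; rewrite -(cvg_shiftn L).
exact: (cvg_unique (@norm_hausdorff _ _) c3 c1).
Qed.

Lemma latshift_inj q m : injective (latshift q m).
Proof.
move=> b b' e; apply/funext => i; have := congr1 (fun m => m i) e.
by rewrite /latshift => /addrI/mulfI; apply; rewrite eqz_nat expn_eq0.
Qed.

Definition zlat n (k : {ffun 'I_d -> 'I_n}) : lat d := fun i => (k i)%:Z.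

(** Euclidean division by n = 2^q makes (k, b) -> k + n b injective, and the pairs with b in the box
    N cover that box. There are finitely many classes k, so the limit passes through the outer
    sum. *)
Lemma zsum_regroup q f G : dominated f G ->
  zsumR f = \sum_(k : Jq d q) zsumR (fun b => f (latshift q (zlat k) b)).
Proof.
move=> h; set n := (2 ^ q)%N; have n0 : (0 < n)%N by rewrite expn_gt0.
pose a N (kb : Jq d q * {ffun 'I_d -> 'I_(2 * N).+1}) : lat d :=
  latshift q (zlat kb.1) (boxpt kb.2).
have inja N : injective (@a N).
  move=> [k b] [k' b'] /= e.
  have eq1 i : k i = k' i /\ boxpt b i = boxpt b' i.
    have := congr1 (fun m => m i) e; rewrite /a /latshift /zlat /= -/n => e'.
    have l1 := ltn_ord (k i); have l2 := ltn_ord (k' i); rewrite -/n in l1 l2.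
    have e2 : (k i : nat) = k' i.
      have := congr1 (fun x => (x %% n)%Z) e'.
      rewrite ![(Posz _ + _)%R]addrC !(mulrC n%:Z) !modzMDl.
      rewrite !modz_small ?lez_nat ?ltz_nat ?l1 ?l2 //.
      by case.
    split; first exact: val_inj.
    by move: e'; rewrite e2 => /addrI/mulfI; apply; lia.
  congr pair; first by apply/ffunP => i; case: (eq1 i).
  by apply: boxpt_inj; apply/funext => i; case: (eq1 i).
have sub N k : exists i, @a N i = @boxpt d N k.
  have lt i : (absz (boxpt k i %% n)%Z < n)%N.
    have := ltz_pmod (boxpt k i) (d := n%:Z).
    by have := modz_ge0 (boxpt k i) (d := n%:Z); lia.
  (* Floor division by n >= 1 maps [-N, N] into itself, so the quotients need no larger box. *)
  have [|b hb] := @mem_box N (fun i => (boxpt k i %/ n)%Z).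
    move=> i; have := boxpt_le k i; nia.
  exists ([ffun i => Ordinal (lt i)], b); apply/funext => i.
  rewrite /a /latshift /zlat /= ffunE hb /= -/n.
  have := modz_ge0 (boxpt k i) (d := n%:Z); have := divz_eq (boxpt k i) n; lia.
have c1 := zsum_cvg_fin h inja sub.
have E : (fun N => \sum_i f (@a N i)) =
    (fun N => \sum_(k : Jq d q) boxsumR (fun b => f (latshift q (zlat k) b)) N).
  apply/funext => N.
  by rewrite -(pair_bigA _ (fun k b => f (latshift q (zlat k) (boxpt b)))).
rewrite E in c1; apply: (cvg_unique (@norm_hausdorff _ _) c1).
apply: cvg_big => [|k _]; first exact: add_continuous.
exact: boxsum_cvg (dominated_comp_inj (@latshift_inj q (zlat k)) h).
Qed.

End LatticeSums.

(** * Moduli, and lattice sums of complex families *)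

Section ComplexSums.
Variable R : realType.
Implicit Types z w : R[i].

Lemma cabs_normc z : cabs z = ComplexField.Normc.normc z.
Proof. by case: z. Qed.

Lemma cabsM z w : cabs (z * w) = cabs z * cabs w.
Proof. by rewrite !cabs_normc ComplexField.Normc.normcM. Qed.

Lemma cabs_real (x : R) : 0 <= x -> cabs x%:C = x.
Proof. by move=> x0; rewrite /cabs /= expr0n addr0 sqrtr_sqr ger0_norm. Qed.

Lemma cabs_conj z : cabs (cconj z) = cabs z.
Proof. by rewrite /cabs /= sqrrN. Qed.

Lemma cabs_ge0 z : 0 <= cabs z.
Proof. exact: sqrtr_ge0. Qed.

Lemma Re_le_cabs z : `|complex.Re z| <= cabs z.
Proof. by rewrite -sqrtr_sqr ler_sqrt ?addr_ge0 ?sqr_ge0// lerDl sqr_ge0. Qed.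

Lemma Im_le_cabs z : `|complex.Im z| <= cabs z.
Proof. by rewrite -sqrtr_sqr ler_sqrt ?addr_ge0 ?sqr_ge0// lerDr sqr_ge0. Qed.

Lemma cabs_phi d (m : lat d) (x : pt R d) : cabs (phi m x) = 1.
Proof. by rewrite /cabs /= cos2Dsin2 sqrtr1. Qed.

Lemma Re_mul z w : complex.Re (z * w) =
  complex.Re z * complex.Re w - complex.Im z * complex.Im w.
Proof. by case: z; case: w. Qed.

Lemma Im_mul z w : complex.Im (z * w) =
  complex.Re z * complex.Im w + complex.Im z * complex.Re w.
Proof. by case: z; case: w. Qed.

Lemma Re_sub (z w : R[i]) : complex.Re (z - w) = complex.Re z - complex.Re w.
Proof. by case: z; case: w. Qed.

Lemma Im_sub (z w : R[i]) : complex.Im (z - w) = complex.Im z - complex.Im w.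
Proof. by case: z; case: w. Qed.

Lemma Re_sum (I : Type) (r : seq I) (P : pred I) (F : I -> R[i]) :
  complex.Re (\sum_(i <- r | P i) F i) = \sum_(i <- r | P i) complex.Re (F i).
Proof. by apply: (big_morph (@complex.Re R)) => // -[? ?] []. Qed.

Lemma Im_sum (I : Type) (r : seq I) (P : pred I) (F : I -> R[i]) :
  complex.Im (\sum_(i <- r | P i) F i) = \sum_(i <- r | P i) complex.Im (F i).
Proof. by apply: (big_morph (@complex.Im R)) => // -[? ?] []. Qed.

Lemma complexP z w : complex.Re z = complex.Re w -> complex.Im z = complex.Im w -> z = w.
Proof. by case: z; case: w => /= a b c e -> ->. Qed.

Variable d : nat.
Implicit Types f g : lat d -> R[i].
Local Open Scope classical_set_scope.

Lemma dominated_Re f : abs_summable f ->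
  dominated (fun m => complex.Re (f m)) (fun m => cabs (f m)).
Proof. by move=> h; split => // m; apply: Re_le_cabs. Qed.

Lemma dominated_Im f : abs_summable f ->
  dominated (fun m => complex.Im (f m)) (fun m => cabs (f m)).
Proof. by move=> h; split => // m; apply: Im_le_cabs. Qed.

Lemma abs_summable_le f g : (forall m, cabs (f m) <= cabs (g m)) ->
  abs_summable g -> abs_summable f.
Proof.
move=> fg [B hB]; exists B => N; apply: le_trans (hB N).
by apply: ler_sum => k _; apply: fg.
Qed.

Lemma abs_summable_comp_inj f (s : lat d -> lat d) : injective s ->
  abs_summable f -> abs_summable (f \o s).
Proof.
by move=> injs hf; apply: bounded_comp_inj hf => // m; apply: cabs_ge0.
Qed.

(** Multiplication by z mixes the real and imaginary sums, so the convergence of both is used for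
    each component. *)
Lemma zsum_scale z f : abs_summable f -> zsum (fun m => z * f m) = z * zsum f.
Proof.
move=> hf.
have cR := boxsum_cvg (dominated_Re hf).
have cI := boxsum_cvg (dominated_Im hf).
apply: complexP; rewrite ?Re_mul ?Im_mul /=.
  rewrite {1}/zsumR.
  have -> : boxsumR (fun m => complex.Re (z * f m)) =
      (fun N => complex.Re z * boxsumR (fun m => complex.Re (f m)) N -
                complex.Im z * boxsumR (fun m => complex.Im (f m)) N).
    apply/funext => N; rewrite /boxsumR !mulr_sumr -sumrB.
    by apply: eq_bigr => k _; rewrite Re_mul.
  apply: cvg_lim => //; apply: cvgB; apply: cvgMr => //.
rewrite {1}/zsumR.
have -> : boxsumR (fun m => complex.Im (z * f m)) =
    (fun N => complex.Re z * boxsumR (fun m => complex.Im (f m)) N +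
              complex.Im z * boxsumR (fun m => complex.Re (f m)) N).
  apply/funext => N; rewrite /boxsumR !mulr_sumr -big_split /=.
  by apply: eq_bigr => k _; rewrite Im_mul.
apply: cvg_lim => //; apply: cvgD; apply: cvgMr => //.
Qed.

Lemma czsum_shift f (m : lat d) : abs_summable f ->
  zsum (fun b => f (latadd b m)) = zsum f.
Proof.
move=> hf; apply: complexP => /=.
  exact: (zsum_shift m (dominated_Re hf)).
exact: (zsum_shift m (dominated_Im hf)).
Qed.

Lemma czsum_regroup q f : abs_summable f ->
  zsum f = \sum_(k : Jq d q) zsum (fun b => f (latshift q (zlat k) b)).
Proof.
move=> hf; apply: complexP; rewrite ?Re_sum ?Im_sum /=.
  exact: zsum_regroup (dominated_Re hf).
exact: zsum_regroup (dominated_Im hf).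
Qed.

End ComplexSums.

(** * Convergence of the sum of |m|^(-2t) for t > d/2 *)

Section PowerSums.
Variable R : realType.

(* Comparing p (2k) and p (2k+1) with r p k bounds the sum S (2N+1) by
   1 + 2 r S N, while S N <= S (2N+1). *)
Lemma self_similar_sum_le (p : nat -> R) (r : R) : 0 <= r -> 2 * r < 1 ->
  (forall n, 0 <= p n) -> p 1 <= 1 ->
  (forall n, (0 < n)%N -> p n.*2 <= r * p n /\ p n.*2.+1 <= r * p n) ->
  forall N, \sum_(n < N) p n.+1 <= (1 - 2 * r)^-1.
Proof.
move=> r0 r1 p0 p1 pr N.
have le1 : \sum_(n < N.*2.+1) p n.+1 <= 1 + 2 * r * \sum_(n < N) p n.+1.
  elim: N => [|N IH]; first by rewrite big_ord_recl !big_ord0 /= mulr0 !addr0.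
  rewrite doubleS 2!big_ord_recr /= [X in _ <= _ + _ * X]big_ord_recr /=.
  have [h1 h2] := pr N.+1 isT; rewrite doubleS in h1 h2.
  move: IH h1 h2; nra.
have le2 : \sum_(n < N) p n.+1 <= \sum_(n < N.*2.+1) p n.+1.
  rewrite -!(big_mkord xpredT (fun n => p n.+1)).
  rewrite [leRHS](@big_cat_nat _ _ _ N) //=; last by rewrite -addnn; lia.
  by rewrite lerDl sumr_ge0.
have h : \sum_(n < N) p n.+1 * (1 - 2 * r) <= 1.
  by rewrite -mulr_suml; move: le1 le2; lra.
by rewrite -[leRHS]mul1r ler_pdivlMr ?subr_gt0// mulr_suml.
Qed.

Lemma norm2_ge0 d (m : lat d) : 0 <= norm2 R m.
Proof. by apply: sumr_ge0 => i _; apply: sqr_ge0. Qed.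

Lemma norm2_ge d (m : lat d) i : ((m i)%:~R : R) ^+ 2 <= norm2 R m.
Proof.
by rewrite /norm2 (bigD1 i) //= lerDl sumr_ge0 // => j _; apply: sqr_ge0.
Qed.

Lemma norm2_ge1 d (m : lat d) : ~~ latzero m -> 1 <= norm2 R m.
Proof.
rewrite /latzero negb_forall => /existsP[i mi]; apply: le_trans (norm2_ge m i).
by rewrite -rmorphXn /= ler1z; nia.
Qed.

(** The Fourier weight of the kernel without the factor (4 pi^2)^(-t), which cancels in the final
    quotient. *)
Definition kap d (t : R) (m : lat d) : R :=
  if latzero m then 0 else powR (norm2 R m) (- t).

Lemma kap_ge0 d t (m : lat d) : 0 <= kap t m.
Proof. by rewrite /kap; case: ifP => // _; apply: powR_ge0. Qed.

Lemma ler_powRN (a b s : R) : 0 <= s -> 0 < a -> a <= b -> powR b (- s) <= powR a (- s).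
Proof.
move=> s0 a0 ab; have b0 := lt_le_trans a0 ab.
rewrite !powRN lef_pV2 ?posrE ?powR_gt0//.
by apply: ge0_ler_powR => //; rewrite nnegrE ltW.
Qed.

(** The square of max(1, n). For nonzero m, [bracket2] of |m_i| is at most |m|^2 for every i,
    including the vanishing coordinates. *)
Definition bracket2 (n : nat) : R := if n == 0%N then 1 else n%:R ^+ 2.

Lemma bracket2_ge1 n : 1 <= bracket2 n.
Proof. by rewrite /bracket2; case: n => [|n]; rewrite ?lexx //= -natrX ler1n expn_gt0. Qed.

Lemma sum_abs_centered (h : nat -> R) N :
  \sum_(j < (2 * N).+1) h (absz ((j : nat)%:Z - N%:Z)%R) = h 0%N + 2 * \sum_(n < N) h n.+1.
Proof.
rewrite -(big_mkord xpredT (fun j : nat => h (absz (j%:Z - N%:Z)%R))).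
elim: N => [|N IH]; first by rewrite muln0 big_nat1 big_ord0 mulr0 !addr0.
rewrite mulnS big_nat_recl // big_nat_recr //=.
have -> : \sum_(0 <= i < (2 * N).+1) h (absz (i.+1%:Z - N.+1%:Z)%R) =
    \sum_(0 <= i < (2 * N).+1) h (absz (i%:Z - N%:Z)%R).
  by apply: eq_bigr => i _; congr h; lia.
rewrite IH big_ord_recr /=.
transitivity (h N.+1 + (h 0%N + 2 * \sum_(n < N) h n.+1 + h N.+1)); last by ring.
by congr (h _ + (_ + h _)); lia.
Qed.

(* |m|^(-2t) is bounded by the product over the d coordinates of
   max(1, |m_i|)^(-2t/d), and each one-dimensional series converges as 2t/d > 1. *)
Lemma kap_bounded d (t : R) : d%:R / 2 < t -> box_bounded (@kap d t).
Proof.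
case: d => [|d] ht.
  exists 0 => N; apply: sumr_le0 => k _; rewrite /kap.
  by have -> : latzero (boxpt k) by apply/forallP => -[].
set D := d.+1 in ht *.
have D0 : 0 < D%:R :> R by rewrite ltr0n.
pose s := t / D%:R.
have s2 : 2^-1 < s by rewrite /s ltr_pdivlMr // mulrC.
have s0 : 0 <= s by apply: le_trans (ltW s2); rewrite invr_ge0.
pose h n := powR (bracket2 n) (- s).
have h0 n : 0 <= h n by apply: powR_ge0.
(* Doubling n multiplies [bracket2 n] by 4 for n > 0, hence [h n] by r; the condition 2 r < 1 says
   exactly that s > 1/2. *)
pose r := powR 4 (- s).
have r0 : 0 <= r by apply: powR_ge0.
have r1 : 2 * r < 1.
  have : powR 4 (2^-1) < powR (4 : R) s.
    by rewrite /powR pnatr_eq0 /= ltr_expR ltr_pM2r // ln_gt0 // ltr1n.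
  rewrite powR12_sqrt // (_ : 4 = 2 ^+ 2) ?sqrtr_sqr ?normr_nat; last by rewrite -natrX.
  move=> h2; rewrite /r powRN ltr_pdivrMr ?powR_gt0 //.
  by rewrite mul1r (_ : (4 : R) = 2 ^+ 2) // -natrX.
have hr n : (0 < n)%N -> h n.*2 <= r * h n /\ h n.*2.+1 <= r * h n.
  case: n => // n _.
  have E : r * h n.+1 = powR (4 * bracket2 n.+1) (- s).
    by rewrite powRM // (le_trans _ (bracket2_ge1 _)).
  have b0 : 0 < 4 * bracket2 n.+1.
    by rewrite mulr_gt0 // (lt_le_trans _ (bracket2_ge1 _)).
  rewrite E; split; apply: ler_powRN => //; rewrite /bracket2 /= -!natrX -natrM ler_nat.
    by rewrite -muln2 expnMn mulnC.
  by nia.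
have sb := self_similar_sum_le r0 r1 h0 _ hr.
pose B := h 0%N + 2 * (1 - 2 * r)^-1.
exists (B ^+ D) => N.
apply: (@le_trans _ _ (\sum_(k : {ffun 'I_D -> 'I_(2 * N).+1})
    \prod_i h (absz ((k i : nat)%:Z - N%:Z)%R))).
  apply: ler_sum => k _; rewrite /kap; case: ifPn => [_|/norm2_ge1 m1].
    by apply: prodr_ge0.
  have -> : powR (norm2 R (boxpt k)) (- t) = \prod_(i < D) powR (norm2 R (boxpt k)) (- s).
    rewrite prodr_const card_ord -powR_mulrn ?powR_ge0 // -powRrM mulNr /s.
    by rewrite divfK // gt_eqF.
  apply: ler_prod => i _; rewrite powR_ge0 /=; apply: ler_powRN => //.
    exact: lt_le_trans (bracket2_ge1 _).
  rewrite /bracket2; case: ifP => // _; apply: le_trans (norm2_ge (boxpt k) i).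
  by rewrite /boxpt natr_absz intr_norm real_normK ?num_real.
(* The sum over the box of a product over coordinates factors into the D-th power of a
   one-dimensional sum. *)
rewrite -(bigA_distr_bigA
  (fun (i : 'I_D) (j : 'I_(2 * N).+1) => h (absz ((j : nat)%:Z - N%:Z)%R))) /=.
rewrite prodr_const card_ord lerXn2r ?nnegrE //.
- by apply: sumr_ge0.
- by rewrite addr_ge0 // mulr_ge0 // invr_ge0 subr_ge0 ltW.
rewrite sum_abs_centered lerD2l ler_pM2l //; apply: sb.
by rewrite /h /bracket2 /= expr1n powR1.
Qed.

End PowerSums.

(** * Iterated integrals over the cube *)

Section CubeIntegral.
Variable R : realType.
Local Open Scope classical_set_scope.
Implicit Types (F G : (nat -> R) -> R) (y z : nat -> R).

Let mu := @lebesgue_measure R.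
Let I01 := `[0%R, 1%R]%classic : set R.

Lemma within01_integrable (f : R -> R) : {within I01, continuous f} ->
  mu.-integrable I01 (EFin \o f).
Proof. exact: continuous_compact_integrable (@segment_compact _ 0 1). Qed.

Lemma Rintegral01_cst (c : R) : Rintegral mu I01 (fun=> c) = c.
Proof.
rewrite Rintegral_cst; last exact: measurable_itv.
rewrite -[RHS]mulr1; congr (c * _).
transitivity (fine (1%:E : \bar R)) => //; congr fine.
by apply: etrans (lebesgue_measure_itv _) _; rewrite /= lte_fin ltr01 oppr0 adde0.
Qed.

Definition unit_seq y := forall k, 0 <= y k <= 1.

(* Uniform continuity on the cube is inherited by partial integrals, which makes
   every iterated integrand below integrable. *)
Definition ucont F := forall e, 0 < e -> exists2 r, 0 < r &
  forall y z, unit_seq y -> unit_seq z -> (forall k, `|y k - z k| < r) ->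
  `|F y - F z| <= e.

Definition upd n (s : R) y : nat -> R := fun k => if k == n then s else y k.

Lemma unit_upd n s y : 0 <= s <= 1 -> unit_seq y -> unit_seq (upd n s y).
Proof. by move=> hs hy k; rewrite /upd; case: ifP. Qed.

Lemma ucont_cst c : ucont (fun=> c).
Proof. by move=> e e0; exists 1 => // y z _ _ _; rewrite subrr normr0 ltW. Qed.

Lemma ucont_lin a F G : ucont F -> ucont G -> ucont (fun y => a * F y + G y).
Proof.
move=> hF hG e e0.
(* The summand 1 keeps the divisor positive when a = 0. *)
have a0 : 0 < `|a| + 1 by rewrite ltr_wpDl.
have e2 : 0 < e / 2 by rewrite divr_gt0.
have [r r0 hr] := hF _ (divr_gt0 e2 a0); have [r' r'0 hr'] := hG _ e2.
exists (Num.min r r') => [|y z uy uz yz]; first by rewrite lt_min r0.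
have {hr} hr : `|F y - F z| <= e / 2 / (`|a| + 1).
  by apply: hr => // k; have := yz k; rewrite lt_min => /andP[].
have {hr'} hr' : `|G y - G z| <= e / 2.
  by apply: hr' => // k; have := yz k; rewrite lt_min => /andP[].
have -> : a * F y + G y - (a * F z + G z) = a * (F y - F z) + (G y - G z) by ring.
rewrite (splitr e) (le_trans (ler_normD _ _)) // lerD // normrM.
rewrite ler_pdivlMr // in hr; apply: le_trans hr.
by rewrite mulrC ler_wpM2l // lerDl.
Qed.

Lemma ucont_upd n s F : 0 <= s <= 1 -> ucont F -> ucont (fun y => F (upd n s y)).
Proof.
move=> hs hF e e0; have [r r0 hr] := hF e e0; exists r => // y z uy uz yz.
apply: hr; [exact: unit_upd | exact: unit_upd |] => k.
by rewrite /upd; case: ifP => // _; rewrite subrr normr0.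
Qed.

Lemma cint_natS n F : cint_nat n.+1 F =
  Rintegral mu I01 (fun s => cint_nat n (fun y => F (upd n s y))).
Proof. by []. Qed.

Lemma cint_nat_cst n c : cint_nat n (fun=> c) = c :> R.
Proof. by elim: n => [|n IH] //; rewrite cint_natS IH Rintegral01_cst. Qed.

(** Linearity and monotonicity are named per level because they are proved by a joint induction:
    together at level n they make the sections continuous, hence integrable, which is what both
    properties require at level n + 1. *)
Definition cint_linear_at n := forall a F G, ucont F -> ucont G ->
  cint_nat n (fun y => a * F y + G y) = a * cint_nat n F + cint_nat n G.
Definition cint_mono_at n := forall F G, ucont F -> ucont G ->
  (forall y, unit_seq y -> F y <= G y) -> cint_nat n F <= cint_nat n G.

(** Uniform continuity gives F at s <= F at s' + e pointwise in the remaining coordinates.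
    Integrating this inequality, and the one with s and s' exchanged, bounds the difference of the
    sections by e. *)
Lemma cint_section_continuous n F : cint_linear_at n -> cint_mono_at n -> ucont F ->
  {within I01, continuous (fun s => cint_nat n (fun y => F (upd n s y)))}.
Proof.
move=> hl hm hF; apply/subspace_continuousP => s0 hs0.
apply/cvgrPdist_le => e e0; have [r r0 hr] := hF e e0.
have hs0' : 0 <= s0 <= 1 by move: hs0; rewrite /I01 /= in_itv.
have le1 s s' : 0 <= s <= 1 -> 0 <= s' <= 1 -> `|s - s'| < r ->
    cint_nat n (fun y => F (upd n s y)) <= cint_nat n (fun y => F (upd n s' y)) + e.
  move=> hs hs' ss.
  have -> : cint_nat n (fun y => F (upd n s' y)) + e =
      cint_nat n (fun y => 1 * F (upd n s' y) + e).
    by rewrite hl ?mul1r ?cint_nat_cst //; [exact: ucont_upd | exact: ucont_cst].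
  apply: hm => [||y uy]; first exact: ucont_upd.
    by apply: ucont_lin; [exact: ucont_upd | exact: ucont_cst].
  rewrite mul1r addrC -lerBlDr; apply: le_trans (ler_norm _) _.
  apply: hr => [||k]; [exact: unit_upd | exact: unit_upd |].
  by rewrite /upd; case: ifP => // _; rewrite subrr normr0.
rewrite near_withinE; near=> s => hs.
have hs' : 0 <= s <= 1 by move: hs; rewrite /I01 /= in_itv.
have ss : `|s0 - s| < r by near: s; exact: nbhsx_ballx.
rewrite ler_distl lerBlDr !le1 // distrC //.
Unshelve. all: by end_near. Qed.

Lemma cint_linear_mono n : cint_linear_at n /\ cint_mono_at n.
Proof.
elim: n => [|n [hl hm]].
  split=> [a F G _ _ //|F G _ _ h /=].
  by apply: h => k; rewrite lexx ler01.
have mI : measurable I01 by exact: measurable_itv.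
have hi F (hF : ucont F) := within01_integrable (cint_section_continuous hl hm hF).
have in01 s : I01 s -> 0 <= s <= 1 by rewrite /I01 /= in_itv.
split=> [a F G hF hG|F G hF hG FG]; rewrite !cint_natS.
  rewrite -RintegralZl ?hi // -RintegralD ?hi //; last first.
    exact: integrableZl (hi _ hF).
  apply: eq_Rintegral => s /set_mem/in01 hs.
  by rewrite hl //; exact: ucont_upd.
apply: le_Rintegral; rewrite ?hi // => s /in01 hs.
apply: hm => [||y uy]; [exact: ucont_upd | exact: ucont_upd |].
by apply: FG; apply: unit_upd.
Qed.

End CubeIntegral.

Section CubeIntegralContinuous.
Variables (R : realType) (d : nat).
Local Open Scope classical_set_scope.
Implicit Types (F G : pt R d -> R) (v w : pt R d -> R[i]) (x : pt R d).

Definition in_cube x := forall i, 0 <= x ord0 i <= 1.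

Lemma row_in_cube y : unit_seq y -> in_cube (\row_(i < d) y (nat_of_ord i)).
Proof. by move=> uy i; rewrite mxE. Qed.

(** Heine-Cantor on the cube, with compactness used in its near-covering form: half the local radius
    at x serves for all centres within that half radius. *)
Lemma ucont_row F : continuous F -> ucont (fun y => F (\row_(i < d) y (nat_of_ord i))).
Proof.
move=> cF e e0.
have cK := @rV_compact R d (fun=> `[0%R, 1%R]%classic) (fun=> @segment_compact R 0 1).
have e2 : 0 < e / 2 by rewrite divr_gt0.
have : \forall r \near 0^'+, [set x : pt R d | forall i, `[0%R, 1%R]%classic (x ord0 i)] `<=`
    (fun x => forall z, ball x r z -> `|F x - F z| <= e).
  apply: ((compact_near_coveringP _).1 cK _ _
    (fun r x => forall z, ball x r z -> `|F x - F z| <= e)).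
  move=> x _.
  have /cvgrPdist_lt/(_ _ e2) := cF x; rewrite near_nbhs => /nbhs_ballP[r /= r0 hr].
  exists (ball x (r / 2), [set s | 0 < s < r / 2]) => /=.
    split; first by apply: nbhsx_ballx; rewrite divr_gt0.
    near=> s; apply/andP; split => //.
    by near: s; apply: nbhs_right_lt; rewrite divr_gt0.
  move=> [x' s] /= [xx' /andP[s0 sr]] z x'z.
  have h1 : ball x r x' by apply: le_ball xx'; rewrite ler_pdivrMr //; move: r0; lra.
  have h2 : ball x r z.
    by rewrite (splitr r); apply: ball_triangle xx' _; apply: le_ball x'z; apply: ltW.
  rewrite (splitr e) -(subrK (F x) (F x')) -addrA (le_trans (ler_normD _ _)) //.
  by rewrite lerD // ?(distrC (F x')) ltW // hr.
move=> nr; have rp : \forall r \near (0 : R)^'+, 0 < r by exact: nbhs_right_gt.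
have [r [hr r0]] := filter_ex (filterI nr rp).
exists r => // y z uy uz yz; apply: hr => [i|]; first by rewrite mxE /= in_itv /= uy.
by split=> // i j; rewrite !mxE; apply: yz.
Unshelve. all: by end_near. Qed.

Lemma cube_int_lin a F G : continuous F -> continuous G ->
  cube_int (fun x => a * F x + G x) = a * cube_int F + cube_int G.
Proof.
by move=> cF cG; apply: (cint_linear_mono R d).1; exact: ucont_row.
Qed.

Lemma cube_int_cst c : cube_int (fun _ : pt R d => c) = c.
Proof. exact: cint_nat_cst. Qed.

Lemma cube_int_le F G : continuous F -> continuous G ->
  (forall x, in_cube x -> F x <= G x) -> cube_int F <= cube_int G.
Proof.
move=> cF cG FG; apply: (cint_linear_mono R d).2; try exact: ucont_row.
by move=> y uy; apply/FG/row_in_cube.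
Qed.

Lemma cube_int_norm_le F e : continuous F -> (forall x, in_cube x -> `|F x| <= e) ->
  `|cube_int F| <= e.
Proof.
move=> cF Fe; rewrite ler_norml -[X in X <= _ <= _]cube_int_cst -{2}[e]cube_int_cst.
have cc c : continuous (fun _ : pt R d => c : R) by exact: cst_continuous.
apply/andP; split; (apply: cube_int_le => //; try exact: cc) => x hx; have := Fe x hx; rewrite ler_norml.
  by case/andP.
by case/andP.
Qed.

End CubeIntegralContinuous.

(** * Integrals of cosines over the cube *)

Section Trigonometric.
Variable R : realType.
Local Open Scope classical_set_scope.

Let mu := @lebesgue_measure R.
Let I01 := `[0%R, 1%R]%classic : set R.

Lemma sinD2piz (a : R) (z : int) : sin (a + 2 * pi * z%:~R) = sin a.
Proof.
have E n : (pi *+ 2) *+ n = 2 * pi * n%:R :> R.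
  by rewrite -[_ *+ n]mulr_natr -[pi *+ 2]mulr_natl.
case: z => n; rewrite ?NegzE ?mulrNz -pmulrn.
  by rewrite -E (periodicn (@sinD2pi R)).
by rewrite -[LHS](periodicn (@sinD2pi R) n.+1) E mulrN subrK.
Qed.

Lemma cosD2piz (a : R) (z : int) : cos (a + 2 * pi * z%:~R) = cos a.
Proof. by rewrite -!sinDpihalf addrAC sinD2piz. Qed.

(** For z nonzero the antiderivative sin (c + 2 pi z s) / (2 pi z) takes the same value at 0 and
    1. *)
Lemma Rintegral01_cos (c : R) (z : int) :
  Rintegral mu I01 (fun s => cos (c + 2 * pi * (z%:~R * s))) = if z == 0 then cos c else 0.
Proof.
have [->|z0] := eqVneq z 0.
  rewrite -[RHS]Rintegral01_cst; congr Rintegral; apply/funext => s.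
  by rewrite mul0r mulr0 addr0.
pose k : R := 2 * pi * z%:~R.
have k0 : k != 0 by rewrite !mulf_neq0 ?pnatr_eq0 ?intr_eq0 // gt_eqF // pi_gt0.
pose F : R -> R := k^-1 \*: (sin \o (cst c + k \*: id)).
have dF (s : R) : is_derive s 1 F (cos (c + k * s)).
  have dg : is_derive s 1 (cst c + k \*: id : R -> R) k.
    by apply: is_derive_eq; rewrite add0r /GRing.scale /= mulr1.
  have := @is_derive1_comp _ (@sin R) (cst c + k \*: id) s _ _ (is_derive_sin _) dg.
  move=> dh; apply: is_derive_eq; rewrite /GRing.scale /=.
  by rewrite mulrCA mulVf // mulr1.
have cf : continuous (fun s : R => cos (c + 2 * pi * (z%:~R * s))).
  move=> s; apply: continuous_comp; last exact: continuous_cos.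
  apply: cvgD; first exact: cvg_cst.
  by apply: cvgMr; apply: cvgMr; exact: cvg_id.
have FE s : F s = k^-1 * sin (c + k * s) by [].
have cF : continuous F.
  by move=> s; apply/differentiable_continuous/derivable1_diffP; exact: (@ex_derive _ _ _ _ _ _ _ (dF s)).
rewrite /Rintegral (@continuous_FTC2 _ _ F) //.
- by rewrite -EFinB /= !FE mulr0 addr0 mulr1 /k sinD2piz subrr.
- exact: continuous_subspaceT.
- split; [|exact: cvg_at_right_filter (cF 0) | exact: cvg_at_left_filter (cF 1)].
  by move=> s _; exact: (@ex_derive _ _ _ _ _ _ _ (dF s)).
- move=> s _; rewrite derive1E (@derive_val _ _ _ _ _ _ _ (dF s)).
  by rewrite /k mulrA.
Qed.

(** The free phase c carries the induction: fixing the outermost coordinate at s adds 2 pi m_n s to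
    it. It also covers sines, through c = - pi / 2. *)
Lemma cint_cos n (m : nat -> int) (c : R) :
  cint_nat n (fun y => cos (c + 2 * pi * \sum_(k < n) (m k)%:~R * y k)) =
  if [forall k : 'I_n, m k == 0] then cos c else 0.
Proof.
elim: n c => [|n IH] c.
  rewrite /= big_ord0 mulr0 addr0; case: ifP => // /negbT; rewrite negb_forall.
  by move=> /existsP[[]].
rewrite cint_natS.
have -> : (fun s => cint_nat n (fun y => cos (c + 2 * pi * \sum_(k < n.+1) (m k)%:~R * upd n s y k))) =
  (fun s => if [forall k : 'I_n, m k == 0] then cos (c + 2 * pi * ((m n)%:~R * s)) else 0).
  apply/funext => s; rewrite -IH; congr cint_nat; apply/funext => y.
  rewrite big_ord_recr /= {2}/upd eqxx mulrDr addrA addrAC; congr (cos (_ + _ * _)).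
  by apply: eq_bigr => k _; rewrite /upd ltn_eqF.
have -> : [forall k : 'I_n.+1, m k == 0] = [forall k : 'I_n, m k == 0] && (m n == 0).
  apply/forallP/andP => [h|[/forallP h1 h2] k].
    by split; [apply/forallP => k; exact: (h (widen_ord (leqnSn n) k)) | exact: (h ord_max)].
  have := ltn_ord k; rewrite ltnS leq_eqVlt => /orP[/eqP->//|kn].
  exact: (h1 (Ordinal kn)).
case: [forall k : 'I_n, m k == 0] => /=; first exact: Rintegral01_cos.
exact: Rintegral01_cst.
Qed.

Variable d : nat.

Lemma cube_int_cos (m : lat d) (c : R) :
  cube_int (fun x : pt R d => cos (c + 2 * pi * dotp m x)) = if latzero m then cos c else 0.
Proof.
(* Extension of m by 0 to all natural indices, as the iterated integral works with sequences. *)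
pose m' k := oapp m 0 (insub k).
have m'E (i : 'I_d) : m' i = m i by rewrite /m' valK.
have -> : latzero m = [forall k : 'I_d, m' k == 0].
  by apply: eq_forallb => k; rewrite m'E.
rewrite -cint_cos /cube_int; congr cint_nat; apply/funext => y.
by congr (cos (_ + _ * _)); apply: eq_bigr => i _; rewrite mxE m'E.
Qed.

End Trigonometric.

(** * Fourier series *)

Section FourierSeries.
Variables (R : realType) (d : nat).
Local Open Scope classical_set_scope.
Implicit Types (v w : pt R d -> R[i]) (x : pt R d) (m : lat d) (g : lat d -> R[i]).

Lemma contD (F G : pt R d -> R) : continuous F -> continuous G ->
  continuous (fun x => F x + G x).
Proof. by move=> cF cG x; apply: continuousD; [exact: cF | exact: cG]. Qed.

Lemma contM (F G : pt R d -> R) : continuous F -> continuous G ->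
  continuous (fun x => F x * G x).
Proof. by move=> cF cG x; apply: continuousM; [exact: cF | exact: cG]. Qed.

Lemma contN (F : pt R d -> R) : continuous F -> continuous (fun x => - F x).
Proof. by move=> cF x; apply: continuousN; exact: cF. Qed.

Lemma contZ (a : R) (F : pt R d -> R) : continuous F -> continuous (fun x => a * F x).
Proof. by move=> cF; apply: contM => //; exact: cst_continuous. Qed.

Lemma cont_sum (I : Type) (r : seq I) (F : I -> pt R d -> R) :
  (forall i, continuous (F i)) -> continuous (fun x => \sum_(i <- r) F i x).
Proof.
move=> cF; elim: r => [|i r IH].
  by under eq_fun do rewrite big_nil; exact: cst_continuous.
by under eq_fun do rewrite big_cons; exact: contD.
Qed.

(** Continuity is taken componentwise, matching the componentwise definition of [fourier]. *)
Definition ccont v := continuous (fun x => complex.Re (v x)) /\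
                      continuous (fun x => complex.Im (v x)).

Definition cube_intC v : R[i] :=
  Complex (cube_int (fun x => complex.Re (v x))) (cube_int (fun x => complex.Im (v x))).

Lemma ccont_cst (z : R[i]) : ccont (fun=> z).
Proof. by split; exact: cst_continuous. Qed.

Lemma ccontD v w : ccont v -> ccont w -> ccont (fun x => v x + w x).
Proof.
move=> [v1 v2] [w1 w2]; split.
  have -> : (fun x => complex.Re (v x + w x)) = (fun x => complex.Re (v x) + complex.Re (w x)).
    by apply/funext => y; case: (v y); case: (w y).
  exact: contD.
have -> : (fun x => complex.Im (v x + w x)) = (fun x => complex.Im (v x) + complex.Im (w x)).
  by apply/funext => y; case: (v y); case: (w y).
exact: contD.
Qed.

Lemma ccontM v w : ccont v -> ccont w -> ccont (fun x => v x * w x).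
Proof.
move=> [v1 v2] [w1 w2]; split.
  rewrite (_ : (fun x => _) = (fun x =>
      complex.Re (v x) * complex.Re (w x) - complex.Im (v x) * complex.Im (w x))).
    by apply: contD; [|apply: contN]; apply: contM.
  by apply/funext => x; rewrite Re_mul.
rewrite (_ : (fun x => _) = (fun x =>
    complex.Re (v x) * complex.Im (w x) + complex.Im (v x) * complex.Re (w x))).
  by apply: contD; apply: contM.
by apply/funext => x; rewrite Im_mul.
Qed.

Lemma ccont_sum (I : Type) (r : seq I) (F : I -> pt R d -> R[i]) :
  (forall i, ccont (F i)) -> ccont (fun x => \sum_(i <- r) F i x).
Proof.
move=> cF; elim: r => [|i r IH].
  by under eq_fun do rewrite big_nil; exact: ccont_cst.
by under eq_fun do rewrite big_cons; exact: ccontD.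
Qed.

Lemma dotp_continuous m : continuous (dotp m : pt R d -> R).
Proof.
by apply: cont_sum => i; apply: contZ; exact: coord_continuous.
Qed.

Lemma ccont_phi m : ccont (@phi R d m).
Proof.
have c : continuous (fun x : pt R d => 2 * pi * dotp m x) by apply/contZ/dotp_continuous.
split=> x; apply: (continuous_comp (c x)).
  exact: continuous_cos.
exact: continuous_sin.
Qed.

Lemma ccont_conj v : ccont v -> ccont (fun x => cconj (v x)).
Proof. by move=> [v1 v2]; split => //; exact: contN. Qed.

Lemma cube_intC_lin (a : R[i]) v w : ccont v -> ccont w ->
  cube_intC (fun x => a * v x + w x) = a * cube_intC v + cube_intC w.
Proof.
move=> [v1 v2] [w1 w2]; case: a => a b; apply: complexP => /=.
  have -> : (fun x => complex.Re (Complex a b * v x + w x)) =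
    (fun x => a * complex.Re (v x) + ((- b) * complex.Im (v x) + complex.Re (w x))).
    by apply/funext => x; case: (v x); case: (w x) => * /=; ring.
  rewrite cube_int_lin // ?cube_int_lin //; first by ring.
  by apply: contD => //; exact: contZ.
have -> : (fun x => complex.Im (Complex a b * v x + w x)) =
  (fun x => a * complex.Im (v x) + (b * complex.Re (v x) + complex.Im (w x))).
  by apply/funext => x; case: (v x); case: (w x) => * /=; ring.
rewrite cube_int_lin // ?cube_int_lin //; first by ring.
by apply: contD => //; exact: contZ.
Qed.

Lemma cube_intC_sum (I : Type) (r : seq I) (a : I -> R[i]) (F : I -> pt R d -> R[i]) :
  (forall i, ccont (F i)) ->
  cube_intC (fun x => \sum_(i <- r) a i * F i x) = \sum_(i <- r) a i * cube_intC (F i).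
Proof.
move=> cF; elim: r => [|i r IH].
  under eq_fun do rewrite big_nil; rewrite big_nil.
  by apply: complexP; rewrite /= cube_int_cst.
under eq_fun do rewrite big_cons; rewrite big_cons -IH cube_intC_lin //.
by apply: ccont_sum => j; apply: ccontM => //; exact: ccont_cst.
Qed.

Lemma cube_intC_phi m : cube_intC (phi m) = (latzero m)%:R.
Proof.
apply: complexP => /=.
  rewrite -[LHS]/(cube_int (fun x => cos (2 * pi * dotp m x))).
  under eq_fun do rewrite -[2 * pi * _]add0r.
  by rewrite cube_int_cos cos0; case: latzero.
rewrite -[LHS]/(cube_int (fun x => sin (2 * pi * dotp m x))).
(* The sine is a cosine of phase - pi / 2, and the cosine of that phase vanishes, so the integral is
   0 for every m. *)
under eq_fun do rewrite -cosBpihalf addrC.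
by rewrite cube_int_cos cosN cos_pihalf; case: latzero.
Qed.

Lemma dotp_latadd m m' x : dotp (latadd m m') x = dotp m x + dotp m' x.
Proof.
by rewrite /dotp -big_split /=; apply: eq_bigr => i _; rewrite intrD mulrDl.
Qed.

Lemma dotp_latopp m x : dotp (latopp m) x = - dotp m x.
Proof.
by rewrite /dotp -sumrN; apply: eq_bigr => i _; rewrite mulrNz mulNr.
Qed.

Lemma dotpD m x y : dotp m (x + y) = dotp m x + dotp m y.
Proof.
by rewrite /dotp -big_split /=; apply: eq_bigr => i _; rewrite mxE mulrDr.
Qed.

Lemma phi_latadd m m' x : phi (latadd m m') x = phi m x * phi m' x.
Proof.
rewrite /phi dotp_latadd mulrDr cosD sinD; apply: complexP => //=.
by rewrite addrC.
Qed.

Lemma phi_latopp m x : phi (latopp m) x = cconj (phi m x).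
Proof. by rewrite /phi dotp_latopp mulrN cosN sinN. Qed.

Lemma phi_periodic m x (i : 'I_d) : phi m (x + \row_(j < d) (j == i)%:R) = phi m x.
Proof.
rewrite /phi dotpD.
have -> : dotp m (\row_(j < d) (j == i)%:R : pt R d) = (m i)%:~R.
  rewrite /dotp (bigD1 i) //= mxE eqxx mulr1 big1 ?addr0 // => j /negbTE ji.
  by rewrite mxE ji mulr0.
by rewrite mulrDr cosD2piz sinD2piz.
Qed.

Definition fser g x : R[i] := zsum (fun m => g m * phi m x).
Definition fpart g N x : R[i] :=
  \sum_(k : {ffun 'I_d -> 'I_(2 * N).+1}) g (boxpt k) * phi (boxpt k) x.

Lemma abs_summable_phi g x : abs_summable g -> abs_summable (fun m => g m * phi m x).
Proof. by apply: abs_summable_le => m; rewrite cabsM cabs_phi mulr1. Qed.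

Lemma ccont_fpart g N : ccont (fpart g N).
Proof.
by apply: ccont_sum => k; apply: ccontM; [exact: ccont_cst | exact: ccont_phi].
Qed.

(** Since characters have modulus 1, the bound is independent of x: convergence is uniform. *)
Lemma fser_dist g N x : abs_summable g ->
  `|complex.Re (fser g x) - complex.Re (fpart g N x)| <= tail (fun m => cabs (g m)) N /\
  `|complex.Im (fser g x) - complex.Im (fpart g N x)| <= tail (fun m => cabs (g m)) N.
Proof.
move=> hg; have h := abs_summable_phi x hg.
have E : (fun m => cabs (g m)) = (fun m => cabs (g m * phi m x)).
  by apply/funext => m; rewrite cabsM cabs_phi mulr1.
rewrite E Re_sum Im_sum; split.
  exact: (boxsum_dist N (dominated_Re h)).
exact: (boxsum_dist N (dominated_Im h)).
Qed.

Lemma tail_small g (e : R) : abs_summable g -> 0 < e ->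
  \forall N \near \oo, tail (fun m => cabs (g m)) N <= e.
Proof.
move=> hg e0.
have /cvgrPdist_le/(_ e e0) := tail_cvg0 (fun m => cabs_ge0 (g m)) hg.
by apply: filterS => N; rewrite sub0r normrN; apply: le_trans (ler_norm _).
Qed.

Lemma uniform_approx_continuous (F : pt R d -> R) :
  (forall e, 0 < e -> exists2 P : pt R d -> R, continuous P & forall x, `|F x - P x| <= e) ->
  continuous F.
Proof.
move=> h x; apply/(@cvgrPdist_le _ _ _ _ (nbhs_filter x)) => e e0.
have e3 : 0 < e / 3 by rewrite divr_gt0.
have [P cP hP] := h _ e3.
have /cvgrPdist_le/(_ _ e3) := cP x; apply: (@filterS _ _ (nbhs_filter x)) => y hy.
have -> : F x - F y = (F x - P x) + (P x - P y) - (F y - P y) by ring.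
rewrite (_ : e = e / 3 + e / 3 + e / 3); last by field.
by rewrite (le_trans (ler_normB _ _)) // lerD // (le_trans (ler_normD _ _)) // lerD.
Qed.

Lemma ccont_fser g : abs_summable g -> ccont (fser g).
Proof.
move=> hg; split; apply: uniform_approx_continuous => e e0;
  have [N /= hN] := filter_ex (tail_small hg e0).
  exists (fun x => complex.Re (fpart g N x)); first exact: (ccont_fpart g N).1.
  by move=> x; apply: le_trans hN; have [] := fser_dist N x hg.
exists (fun x => complex.Im (fpart g N x)); first exact: (ccont_fpart g N).2.
by move=> x; apply: le_trans hN; have [] := fser_dist N x hg.
Qed.

Lemma fser_periodic g : torus_periodic (fser g).
Proof.
by move=> x i; rewrite /fser; congr zsum; apply/funext => m; rewrite phi_periodic.
Qed.

Lemma fourier_fpart g N m : (forall i, `|m i| <= N)%N -> fourier (fpart g N) m = g m.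
Proof.
move=> mN; have [k0 hk0] := mem_box mN.
rewrite -[LHS]/(cube_intC (fun x => fpart g N x * cconj (phi m x))).
have -> : (fun x => fpart g N x * cconj (phi m x)) =
    (fun x => \sum_(k : {ffun 'I_d -> 'I_(2 * N).+1})
        g (boxpt k) * phi (latadd (boxpt k) (latopp m)) x).
  apply/funext => x; rewrite mulr_suml; apply: eq_bigr => k _.
  by rewrite phi_latadd phi_latopp mulrA.
rewrite cube_intC_sum; last by move=> k; exact: ccont_phi.
rewrite (bigD1 k0) //= big1 ?addr0 => [|k kk0].
  rewrite hk0 cube_intC_phi (_ : latzero _ = true) ?mulr1 //.
  by apply/forallP => i; rewrite /latadd /latopp subrr.
rewrite cube_intC_phi (_ : latzero _ = false) ?mulr0 //.
apply/negbTE; apply: contra kk0 => /forallP h; apply/eqP/boxpt_inj.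
rewrite hk0; apply/funext => i; have := h i.
by rewrite /latadd /latopp subr_eq0 => /eqP.
Qed.

Lemma cabs_le z : cabs z <= `|complex.Re z| + `|complex.Im z| :> R.
Proof.
rewrite -[leRHS]ger0_norm ?addr_ge0 // -sqrtr_sqr ler_sqrt ?sqr_ge0 //.
rewrite -(real_normK (num_real (complex.Re z))) -(real_normK (num_real (complex.Im z))).
have := normr_ge0 (complex.Re z); have := normr_ge0 (complex.Im z); nra.
Qed.

(** Once the box contains m, the partial sum has m-th coefficient exactly g m. Uniform convergence
    makes the remaining difference at most twice a vanishing tail. *)
Lemma fourier_fser g m : abs_summable g -> fourier (fser g) m = g m.
Proof.
move=> hg.
have cJ := ccont_conj (ccont_phi m).
have [c1 c2] := ccontM (ccont_fser hg) cJ.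
have le1 N x : cabs (fser g x * cconj (phi m x) - fpart g N x * cconj (phi m x)) <=
    tail (fun m => cabs (g m)) N + tail (fun m => cabs (g m)) N.
  rewrite -mulrBl cabsM cabs_conj cabs_phi mulr1 (le_trans (cabs_le _)) //.
  have [h1 h2] := fser_dist N x hg.
  by rewrite lerD //; move: h1 h2; case: fser; case: fpart.
have small (A : R[i] -> R) :
  (forall N, `|A (fourier (fser g) m) - A (fourier (fpart g N) m)| <=
    tail (fun m => cabs (g m)) N + tail (fun m => cabs (g m)) N) ->
  A (fourier (fser g) m) = A (g m).
  move=> h; apply/eqP; rewrite -subr_eq0 -normr_le0; apply/ler_addgt0Pl => e e0.
  rewrite addr0.
  have e2 : 0 < e / 2 by rewrite divr_gt0.
  have bigN : \forall N \near \oo, (\max_i `|m i| <= N)%N by exists (\max_i `|m i|)%N.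
  have [N [/= hN1 hN2]] := filter_ex (filterI (tail_small hg e2) bigN).
  have := h N; rewrite fourier_fpart => [hN|i]; last exact: leq_trans (leq_bigmax i) hN2.
  by rewrite (le_trans hN) // (splitr e) lerD.
apply: complexP.
  apply: (small (@complex.Re R)) => N.
  have [p1 p2] := ccontM (ccont_fpart g N) cJ.
  rewrite /fourier /= -mulN1r addrC -cube_int_lin //.
  apply: cube_int_norm_le => [|x _]; first by apply: contD => //; exact: contZ.
  apply: le_trans (le1 N x); apply: (le_trans _ (Re_le_cabs _)).
  by rewrite Re_sub mulN1r addrC.
apply: (small (@complex.Im R)) => N.
have [p1 p2] := ccontM (ccont_fpart g N) cJ.
rewrite /fourier /= -mulN1r addrC -cube_int_lin //.
apply: cube_int_norm_le => [|x _]; first by apply: contD => //; exact: contZ.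
apply: le_trans (le1 N x); apply: (le_trans _ (Im_le_cabs _)).
by rewrite Im_sub mulN1r addrC.
Qed.

End FourierSeries.

(** * Fejér kernel *)

Section Uniqueness.
Variables (R : realType) (d : nat).
Local Open Scope classical_set_scope.
Implicit Types (f : pt R d -> R) (x y : pt R d) (m : lat d).

Lemma periodic_lat (T : Type) (f : pt R d -> T) :
  (forall x (i : 'I_d), f (x + \row_(j < d) (j == i)%:R) = f x) ->
  forall x (l : lat d), f (x + \row_(j < d) (l j)%:~R) = f x.
Proof.
move=> per x l; pose e (i : 'I_d) : pt R d := \row_(j < d) (j == i)%:R.
have perz i z y : f (y + e i *~ z) = f y.
  have pern n y' : f (y' + e i *+ n) = f y'.
    by elim: n => [|n IH]; [rewrite mulr0n addr0 | rewrite mulrSr addrA per].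
  case: z => n; first by rewrite -pmulrn pern.
  by rewrite NegzE mulrNz -pmulrn -[LHS](pern n.+1) subrK.
have -> : \row_(j < d) (l j)%:~R = \sum_i e i *~ l i.
  apply/rowP => j; rewrite mxE summxE (bigD1 j) //= big1 ?addr0 => [|i /negbTE ij].
    by rewrite -[e j *~ _]scaler_int mxE /e mxE eqxx mulr1.
  by rewrite -[e i *~ _]scaler_int mxE /e mxE eq_sym ij mulr0.
elim: (index_enum _) => [|i r IH]; first by rewrite big_nil addr0.
by rewrite big_cons [X in x + X]addrC addrA perz.
Qed.

(** Here s is a difference of two coordinates in [0,1], so only the integers -1, 0, 1 matter. Away
    from them, |s| or its reflection 1 - |s| lies in [r, 1/2], where cos (2 pi s) decreases. *)
Lemma cos_near_int (s r : R) : -1 <= s <= 1 -> 0 < r -> r <= 1 / 2 ->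
  (exists l : int, `|s - l%:~R| < r) \/ cos (2 * pi * s) <= cos (2 * pi * r).
Proof.
move=> /andP[s1 s2] r0 r2.
have pi0 := pi_gt0 R.
have mono (a b : R) : 0 <= a -> a <= b -> b <= 1 / 2 -> cos (2 * pi * b) <= cos (2 * pi * a).
  move=> a0 ab b2.
  have [->//|nab] := eqVneq a b.
  apply/ltW; rewrite ltr_cos ?in_itv /=.
  - by rewrite ltr_pM2l ?mulr_gt0 // lt_neqAle nab.
  - by apply/andP; split; nra.
  - by apply/andP; split; nra.
have [h1|h1] := ltP `|s| r; first by left; exists 0; rewrite subr0.
have [h2|h2] := ltP (1 - r) `|s|.
  left; have [s0|s0] := ger0P s.
    by exists 1; rewrite (ger0_norm s0) in h2; rewrite ltr_norml; apply/andP; split; lra.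
  by exists (-1); rewrite (ltr0_norm s0) in h2; rewrite ltr_norml; apply/andP; split; lra.
right; have -> : cos (2 * pi * s) = cos (2 * pi * `|s|).
  by case: (ger0P s) => // _; rewrite mulrN cosN.
have [h3|h3] := leP `|s| (1 / 2); first by apply: mono => //; exact: ltW.
have -> : cos (2 * pi * `|s|) = cos (2 * pi * (1 - `|s|)).
  rewrite -[LHS]cosN -(cosD2piz _ 1); congr cos; ring.
by apply: mono; [apply: ltW | lra | lra].
Qed.

Lemma cos_mulcos (a b : R) : cos a * cos b = 2^-1 * cos (a + b) + 2^-1 * cos (a - b).
Proof. by rewrite cosD cosB; field. Qed.

Lemma cont_bounded_cube f : continuous f -> exists2 B, 0 <= B & forall x, in_cube x -> `|f x| <= B.
Proof.
move=> cf.
have cK := @rV_compact R d (fun=> `[0%R, 1%R]%classic) (fun=> @segment_compact R 0 1).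
have := compact_bounded (continuous_compact (continuous_subspaceT cf) cK).
move=> [M [_ hM]]; exists (`|M| + 1) => [|x hx]; first by rewrite addr_ge0.
apply: hM; first by rewrite (le_lt_trans (ler_norm _)) // ltrDl.
by exists x => // i; rewrite /= in_itv /= hx.
Qed.

(* Near x0 modulo Z^d continuity and periodicity give e; elsewhere some
   1 - cos is bounded below, so a large multiple absorbs the bound of f. *)
Lemma periodic_dist_le f x0 e : continuous f ->
  (forall x (i : 'I_d), f (x + \row_(j < d) (j == i)%:R) = f x) ->
  in_cube x0 -> 0 < e ->
  exists2 C, 0 <= C & forall y, in_cube y ->
    `|f x0 - f y| <= e + C * \sum_(i < d) (1 - cos (2 * pi * (y ord0 i - x0 ord0 i))).
Proof.
move=> cf per hx0 e0; have [B B0 hB] := cont_bounded_cube cf.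
have /(@cvgrPdist_lt _ _ _ _ (nbhs_filter x0))/(_ _ e0) := cf x0.
rewrite near_nbhs => /nbhs_ballP[r /= r0 hr].
(* The cap 1/2 keeps 2 pi r' in [0, pi], where the cosine is monotone. *)
pose r' := Num.min r (1 / 2).
have r'0 : 0 < r' by rewrite lt_min r0 divr_gt0.
have r'r : r' <= r by rewrite ge_min lexx.
have r'2 : r' <= 1 / 2 by rewrite ge_min lexx orbT.
pose h := 1 - cos (2 * pi * r').
have pi0 := pi_gt0 R.
have h0 : 0 < h.
  rewrite subr_gt0 -[ltRHS]cos0 ltr_cos ?in_itv /= ?lexx ?pi_ge0 //; first by nra.
  by apply/andP; split; nra.
(* 2 B bounds |f x0 - f y| everywhere, and h is the least size of some 1 - cos when y is far from x0
   modulo the lattice. *)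
exists (2 * B / h) => [|y hy]; first by rewrite divr_ge0 ?mulr_ge0 // ltW.
have S0 i : 0 <= 1 - cos (2 * pi * (y ord0 i - x0 ord0 i)) by rewrite subr_ge0 cos_le1.
have C0 : 0 <= 2 * B / h by rewrite divr_ge0 ?mulr_ge0 // ltW.
have [[l hl]|] := pselect (exists l : lat d, forall i, `|y ord0 i - x0 ord0 i - (l i)%:~R| < r').
  apply: (@le_trans _ _ e); last by rewrite lerDl; apply: mulr_ge0 => //; exact: sumr_ge0.
  rewrite -(periodic_lat per y (latopp l)); apply/ltW/hr.
  split=> // i j; rewrite !mxE ord1 /latopp mulrNz.
  rewrite /ball /= distrC; apply: lt_le_trans r'r; apply: le_lt_trans (hl j).
  by rewrite le_eqVlt; apply/orP; left; apply/eqP; congr Num.norm; ring.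
move=> nl.
(* If every coordinate were close to some integer, choosing these integers would give a lattice
   point close to y - x0. *)
have [i hi] : exists i, ~ exists l : int, `|y ord0 i - x0 ord0 i - l%:~R| < r'.
  apply/existsNP => hall; apply: nl.
  by have [l hl] := choice hall; exists l.
have [//|hc] : (exists l : int, `|y ord0 i - x0 ord0 i - l%:~R| < r') \/
    cos (2 * pi * (y ord0 i - x0 ord0 i)) <= cos (2 * pi * r').
  apply: cos_near_int => //.
  by have /andP[a1 a2] := hy i; have /andP[b1 b2] := hx0 i; apply/andP; split; lra.
rewrite (@le_trans _ _ (2 * B)) //.
  by rewrite (le_trans (ler_normB _ _)) // mulr_natl mulr2n lerD // hB.
rewrite ler_wpDl ?(ltW e0) //.
rewrite -{1}[2 * B](@divfK _ h) ?gt_eqF // ler_wpM2l //.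
rewrite (bigD1 i) //= ler_wpDr ?sumr_ge0 // /h; move: hc; lra.
Qed.

Variables (N : nat) (x0 : pt R d).

Let I := {ffun 'I_d -> 'I_N.+1}.
Let M : R := N.+1%:R.
Let th (k : I) y := 2 * pi * (dotp (zlat k) y - dotp (zlat k) x0).

(** The squared modulus of the sum of exp(2 pi i <k, y - x0>) over k in {0,...,N}^d: the product of
    one-dimensional Fejér kernels centred at x0, with total mass M^d. *)
Definition fejer y : R := (\sum_(k : I) cos (th k y)) ^+ 2 + (\sum_(k : I) sin (th k y)) ^+ 2.

Lemma fejer_ge0 y : 0 <= fejer y.
Proof. by rewrite addr_ge0 ?sqr_ge0. Qed.

Let diff (k l : I) := latadd (zlat k) (latopp (zlat l)).

Lemma fejerE y : fejer y = \sum_(k : I) \sum_(l : I)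
   cos (- (2 * pi * dotp (diff k l) x0) + 2 * pi * dotp (diff k l) y).
Proof.
rewrite /fejer !expr2 !big_distrlr /= -big_split /=; apply: eq_bigr => k _.
rewrite -big_split /=; apply: eq_bigr => l _.
rewrite -cosB /diff !dotp_latadd !dotp_latopp /th; congr cos; ring.
Qed.

Lemma fejer_continuous : continuous fejer.
Proof.
have c k : continuous (th k).
  by apply: contZ; apply: contD; [exact: dotp_continuous | exact: cst_continuous].
apply: contD; under eq_fun do rewrite expr2; apply: contM; apply: cont_sum => k y;
  apply: (continuous_comp (c k y)); by [exact: continuous_cos | exact: continuous_sin].
Qed.

Lemma diff0 k l : latzero (diff k l) = (k == l).
Proof.
apply/forallP/eqP => [h|-> i]; last by rewrite /diff /latadd /latopp subrr.
apply/ffunP => i; apply/val_inj; have := h i; rewrite /diff /latadd /latopp /zlat /=; lia.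
Qed.

Lemma cube_int_sum (T : Type) (r : seq T) (F : T -> pt R d -> R) :
  (forall i, continuous (F i)) ->
  cube_int (fun x => \sum_(i <- r) F i x) = \sum_(i <- r) cube_int (F i).
Proof.
move=> cF; elim: r => [|i r IH].
  by under eq_fun do rewrite big_nil; rewrite big_nil cube_int_cst.
under eq_fun do rewrite big_cons -[F i _]mul1r; rewrite big_cons cube_int_lin ?mul1r ?IH //.
exact: cont_sum.
Qed.

Lemma cube_intZ a (F : pt R d -> R) : continuous F ->
  cube_int (fun x => a * F x) = a * cube_int F.
Proof.
move=> cF; under eq_fun do rewrite -[a * _]addr0.
by rewrite cube_int_lin ?cube_int_cst ?addr0 //; exact: cst_continuous.
Qed.

Lemma cos_dotp_continuous m c : continuous (fun y : pt R d => cos (c + 2 * pi * dotp m y)).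
Proof.
have c' : continuous (fun y : pt R d => c + 2 * pi * dotp m y).
  by apply: contD; [exact: cst_continuous | exact/contZ/dotp_continuous].
by move=> y; apply: (continuous_comp (c' y)); exact: continuous_cos.
Qed.

Lemma cube_int_fejer : cube_int fejer = M ^+ d.
Proof.
rewrite (funext fejerE).
rewrite cube_int_sum; last by move=> k; apply: cont_sum => l; exact: cos_dotp_continuous.
transitivity (\sum_(k : I) (1 : R)).
  apply: eq_bigr => k _; rewrite cube_int_sum; last by move=> l; exact: cos_dotp_continuous.
  rewrite (bigD1 k) //= big1 => [|l lk]; rewrite cube_int_cos diff0.
    by rewrite eqxx addr0 (_ : - _ = 0) ?cos0 // /diff dotp_latadd dotp_latopp subrr mulr0 oppr0.
  by rewrite eq_sym (negbTE lk).
by rewrite sumr_const card_ffun !card_ord -natrX.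
Qed.

(** The indicator is a product over coordinates, so the sum factors: coordinate i contributes 1 and
    every other one M. *)
Lemma fejer_last_count (i : 'I_d) :
  \sum_(k : I) ((k i == ord_max)%:R : R) = M ^+ d / M.
Proof.
transitivity (\sum_(k : I) \prod_j (if j == i then (k j == ord_max)%:R else 1 : R)).
  apply: eq_bigr => k _; rewrite (bigD1 i) //= eqxx big1 ?mulr1 // => j /negbTE ->.
  by [].
rewrite -(bigA_distr_bigA (fun (j : 'I_d) (a : 'I_N.+1) => if j == i then (a == ord_max)%:R else 1 : R)) /=.
rewrite (bigD1 i) //= eqxx (bigD1 (@ord_max N)) //= eqxx big1 ?addr0 ?mul1r => [|a /negbTE -> //].
have M0 : M != 0 by rewrite pnatr_eq0.
apply: (mulIf M0); rewrite divfK //.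
transitivity (\prod_(j < d) M); last by rewrite prodr_const card_ord.
rewrite [RHS](bigD1 i) //= mulrC; congr (_ * _); apply: eq_bigr => j /negbTE ->.
by rewrite sumr_const card_ord.
Qed.

Definition unitlat (i : 'I_d) : lat d := fun j => (j == i)%:Z.

(** Each k outside the last layer k_i = N has the partner k + e_i inside the index box; the layer
    removed has M^d / M points. *)
Lemma sum_shift_count (i : 'I_d) (P : I -> I -> bool) :
  (forall k l : I, (forall j, (l j : nat) = (k j + (j == i))%N) -> P k l) ->
  M ^+ d - M ^+ d / M <= \sum_(k : I) \sum_(l : I) ((P k l)%:R : R).
Proof.
move=> hP.
have -> : M ^+ d - M ^+ d / M = \sum_(k : I) (1 - (k i == ord_max)%:R).
  by rewrite big_split /= sumrN fejer_last_count sumr_const card_ffun !card_ord -natrX.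
apply: ler_sum => k _; have [ki|ki] := eqVneq (k i) ord_max.
  by rewrite subrr sumr_ge0.
rewrite subr0.
have lt j : ((k j + (j == i))%N < N.+1)%N.
  have [->|ji] := eqVneq j i; last by rewrite addn0.
  by have := ltn_ord (k i); have : (k i : nat) != N by []; lia.
rewrite (bigD1 [ffun j => Ordinal (lt j)]) //= hP ?ler_wpDr ?sumr_ge0 // => j.
by rewrite ffunE.
Qed.

(** Product-to-sum shifts the frequencies k - l by plus and minus e_i. Only zero frequencies survive
    integration, with phase 0, and each sign leaves at least M^d - M^d / M pairs, weighted by
    1/2. *)
Lemma cube_int_fejer_cos (i : 'I_d) :
  M ^+ d - M ^+ d / M <= cube_int (fun y => fejer y * cos (2 * pi * (y ord0 i - x0 ord0 i))).
Proof.
have cE y : y ord0 i - x0 ord0 i = dotp (unitlat i) y - dotp (unitlat i) x0.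
  have E z : dotp (unitlat i) z = z ord0 i :> R.
    rewrite /dotp (bigD1 i) //= /unitlat eqxx mul1r big1 ?addr0 // => j /negbTE ->.
    by rewrite mul0r.
  by rewrite !E.
pose p k l := latadd (diff k l) (unitlat i).
pose n k l := latadd (diff k l) (latopp (unitlat i)).
have -> : (fun y => fejer y * cos (2 * pi * (y ord0 i - x0 ord0 i))) = (fun y =>
    \sum_(k : I) \sum_(l : I)
      (2^-1 * cos (- (2 * pi * dotp (p k l) x0) + 2 * pi * dotp (p k l) y) +
       2^-1 * cos (- (2 * pi * dotp (n k l) x0) + 2 * pi * dotp (n k l) y))).
  apply/funext => y; rewrite fejerE mulr_suml; apply: eq_bigr => k _.
  rewrite mulr_suml; apply: eq_bigr => l _.
  rewrite cE /p /n !dotp_latadd !dotp_latopp.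
  by rewrite cos_mulcos; congr (_ * cos _ + _ * cos _); ring.
have cc m c : continuous (fun y : pt R d => 2^-1 * cos (c + 2 * pi * dotp m y)).
  exact/contZ/cos_dotp_continuous.
rewrite cube_int_sum; last first.
  by move=> k; apply: cont_sum => l; apply: contD; exact: cc.
have E : \sum_(k : I) cube_int (fun y => \sum_(l : I)
      (2^-1 * cos (- (2 * pi * dotp (p k l) x0) + 2 * pi * dotp (p k l) y) +
       2^-1 * cos (- (2 * pi * dotp (n k l) x0) + 2 * pi * dotp (n k l) y))) =
   2^-1 * (\sum_(k : I) \sum_(l : I) ((latzero (p k l))%:R : R)) +
   2^-1 * (\sum_(k : I) \sum_(l : I) ((latzero (n k l))%:R : R)).
  rewrite !mulr_sumr -big_split /=; apply: eq_bigr => k _.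
  rewrite cube_int_sum; last by move=> l; apply: contD; exact: cc.
  rewrite !mulr_sumr -big_split /=; apply: eq_bigr => l _.
  have z0 m : latzero m -> dotp m x0 = 0.
    by move=> /forallP h; rewrite /dotp big1 // => j _; rewrite (eqP (h j)) mul0r.
  rewrite cube_int_lin; [|exact: cos_dotp_continuous|exact: cc].
  rewrite cube_intZ ?cube_int_cos; last exact: cos_dotp_continuous.
  by congr (_ * _ + _ * _); case: ifP => // /z0 ->; rewrite mulr0 oppr0 cos0.
rewrite E.
have h1 : M ^+ d - M ^+ d / M <= \sum_(k : I) \sum_(l : I) ((latzero (p k l))%:R : R).
  apply: (@sum_shift_count i (fun k l => latzero (p k l))) => k l h; apply/forallP => j.
  by rewrite /p /diff /latadd /latopp /zlat /unitlat h; case: (j == i) => /=; lia.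
have h2 : M ^+ d - M ^+ d / M <= \sum_(k : I) \sum_(l : I) ((latzero (n k l))%:R : R).
  (* For the minus sign the surviving pairs are k = l + e_i, so the roles of the two indices are
     swapped. *)
  rewrite exchange_big; apply: (@sum_shift_count i (fun k l => latzero (n l k))) => k l h; apply/forallP => j.
  by rewrite /n /diff /latadd /latopp /zlat /unitlat h; case: (j == i) => /=; lia.
by move: (M ^+ d - _) (\sum_k _) h1 (\sum_k _) h2 => A S1 h1 S2 h2; lra.
Qed.

End Uniqueness.

(** * Fourier inversion *)

Section Inversion.
Variables (R : realType) (d : nat).
Local Open Scope classical_set_scope.
Implicit Types (f : pt R d -> R) (x y : pt R d) (m : lat d) (u v : pt R d -> R[i]).

Lemma cube_int_abs_le (H W : pt R d -> R) : continuous H -> continuous W ->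
  (forall x, in_cube x -> `|H x| <= W x) -> `|cube_int H| <= cube_int W.
Proof.
move=> cH cW HW; rewrite ler_norml lerNl -mulN1r -cube_intZ //.
apply/andP; split; (apply: cube_int_le => //; try exact: contZ) => x hx.
  by rewrite mulN1r lerNl; have := HW x hx; rewrite ler_norml => /andP[].
by rewrite (le_trans (ler_norm _)) // HW.
Qed.

Lemma cube_intD (F G : pt R d -> R) : continuous F -> continuous G ->
  cube_int (fun x => F x + G x) = cube_int F + cube_int G.
Proof.
by move=> cF cG; under eq_fun do rewrite -[F _]mul1r; rewrite cube_int_lin // mul1r.
Qed.

(** The Fejér kernel is a trigonometric polynomial, so orthogonality turns its integral against f x0
    - f into f x0 * M^d. The bound of [periodic_dist_le], integrated against the kernel, gives M^d
    (e/2 + C d / M). *)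
Lemma trig_orthogonal_eq0 f x0 : continuous f ->
  (forall x (i : 'I_d), f (x + \row_(j < d) (j == i)%:R) = f x) ->
  (forall c m, cube_int (fun y => cos (c + 2 * pi * dotp m y) * f y) = 0) ->
  in_cube x0 -> f x0 = 0.
Proof.
move=> cf per orth hx0; apply/eqP; rewrite -normr_le0; apply/ler_addgt0Pl => e e0.
rewrite addr0.
have e2 : 0 < e / 2 by rewrite divr_gt0.
have [C C0 hC] := periodic_dist_le cf per hx0 e2.
(* Each of the d terms 1 - cos integrates to at most M^d / M; this N makes their total, times C and
   relative to M^d, at most e/2. *)
pose N := Num.bound (C * d%:R / (e / 2)); pose M : R := N.+1%:R.
have M0 : 0 < M by rewrite ltr0n.
have hM : C * d%:R / M <= e / 2.
  rewrite ler_pdivrMr // -ler_pdivrMl // mulrC ltW //.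
  have /archi_boundP h : 0 <= C * d%:R / (e / 2) by rewrite divr_ge0 ?mulr_ge0 // ltW.
  by apply: lt_le_trans h _; rewrite ler_nat.
have Md0 : 0 < M ^+ d by rewrite exprn_gt0.
have cF := @fejer_continuous R d N x0.
have orthF : cube_int (fun y => fejer N x0 y * f y) = 0.
  under eq_fun do rewrite fejerE mulr_suml.
  rewrite cube_int_sum; last first.
    move=> k; under eq_fun do rewrite mulr_suml.
    by apply: cont_sum => l; apply: contM => //; exact: cos_dotp_continuous.
  rewrite big1 // => k _; under eq_fun do rewrite mulr_suml.
  rewrite cube_int_sum; last by move=> l; apply: contM => //; exact: cos_dotp_continuous.
  by rewrite big1 // => l _; exact: orth.
have E1 : cube_int (fun y => fejer N x0 y * (f x0 - f y)) = f x0 * M ^+ d.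
  have -> : (fun y => fejer N x0 y * (f x0 - f y)) =
      (fun y => f x0 * fejer N x0 y + (- 1) * (fejer N x0 y * f y)).
    by apply/funext => y; ring.
  rewrite cube_int_lin //; last by apply/contZ/contM.
  rewrite cube_intZ; last exact: contM.
  by rewrite orthF mulr0 addr0 cube_int_fejer.
pose co (i : 'I_d) y := cos (2 * pi * (y ord0 i - x0 ord0 i)).
have cco i : continuous (co i).
  have c : continuous (fun y : pt R d => 2 * pi * (y ord0 i - x0 ord0 i)).
    by apply: contZ; apply: contD; [exact: coord_continuous | exact: cst_continuous].
  by move=> y; apply: (continuous_comp (c y)); exact: continuous_cos.
have cS i : continuous (fun y => fejer N x0 y + (- 1) * (fejer N x0 y * co i y)).
  by apply: contD => //; apply/contZ/contM.
have E2 : cube_int (fun y => fejer N x0 y * (e / 2 + C * \sum_(i < d) (1 - co i y))) <=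
    M ^+ d * (e / 2 + C * d%:R / M).
  have -> : (fun y => fejer N x0 y * (e / 2 + C * \sum_(i < d) (1 - co i y))) =
    (fun y => (e / 2) * fejer N x0 y +
       C * \sum_(i < d) (fejer N x0 y + (- 1) * (fejer N x0 y * co i y))).
    apply/funext => y; rewrite mulrDr mulrC; congr (_ + _); rewrite mulrCA; congr (_ * _).
    by rewrite mulr_sumr; apply: eq_bigr => i _; ring.
  rewrite cube_int_lin //; last by apply/contZ/cont_sum.
  rewrite cube_intZ; last exact: cont_sum.
  rewrite cube_int_fejer mulrDr [e / 2 * _]mulrC lerD2l.
  rewrite (_ : M ^+ d * _ = C * (M ^+ d / M *+ d)); last first.
    by rewrite -mulr_natr; ring.
  rewrite ler_wpM2l // cube_int_sum //.
  have -> : M ^+ d / M *+ d = \sum_(i < d) (M ^+ d / M) by rewrite sumr_const card_ord.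
  apply: ler_sum => i _.
  rewrite cube_intD //; last by apply/contZ/contM.
  rewrite cube_intZ; last exact: contM.
  rewrite cube_int_fejer mulN1r lerBlDr -lerBlDl.
  exact: cube_int_fejer_cos.
have : `|f x0 * M ^+ d| <= M ^+ d * (e / 2 + C * d%:R / M).
  rewrite -E1; apply: le_trans E2; apply: cube_int_abs_le.
  - apply: contM => //; apply: contD; first exact: cst_continuous.
    exact: contN.
  - apply: contM => //; apply: contD; first exact: cst_continuous.
    apply/contZ/cont_sum => i; apply: contD; first exact: cst_continuous.
    exact: contN.
  - move=> y hy; rewrite normrM ger0_norm ?fejer_ge0 // ler_wpM2l ?fejer_ge0 //.
    exact: hC.
rewrite normrM (gtr0_norm Md0) mulrC ler_pM2l // => h.
by rewrite (le_trans h) // [leRHS]splitr lerD2l.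
Qed.

Lemma cos_dotpC c m y : cos (c + 2 * pi * dotp m y) =
  cos c * complex.Re (phi m y) + (- sin c) * complex.Im (phi m y).
Proof. by rewrite cosD mulNr. Qed.

(** The real criterion must be applied to Re v and Im v separately, but a coefficient at m mixes
    them. Since Re phi_m is even and Im phi_m odd in m, the equations at m and -m separate the four
    real integrals. *)
Lemma fourier_eq0 v x0 : ccont v -> torus_periodic v -> (forall m, fourier v m = 0) ->
  in_cube x0 -> v x0 = 0.
Proof.
move=> [v1 v2] per h0 hx0.
have cRe m := (@ccont_phi R d m).1; have cIm m := (@ccont_phi R d m).2.
pose RR m := cube_int (fun y => complex.Re (phi m y) * complex.Re (v y)).
pose RI m := cube_int (fun y => complex.Re (phi m y) * complex.Im (v y)).
pose IR m := cube_int (fun y => complex.Im (phi m y) * complex.Re (v y)).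
pose II m := cube_int (fun y => complex.Im (phi m y) * complex.Im (v y)).
have e1 m : RR m + II m = 0.
  rewrite -cube_intD; [|exact: contM|exact: contM].
  have := congr1 (@complex.Re R) (h0 m); rewrite /= => <-; congr cube_int; apply/funext => y.
  by rewrite Re_mul /=; ring.
have e2 m : RI m - IR m = 0.
  rewrite -[- _]mulN1r -cube_intZ; last exact: contM.
  rewrite -cube_intD; [|exact: contM|by apply/contZ/contM].
  have := congr1 (@complex.Im R) (h0 m); rewrite /= => <-; congr cube_int; apply/funext => y.
  by rewrite Im_mul /=; ring.
have r1 m : RR (latopp m) = RR m.
  by congr cube_int; apply/funext => y; rewrite phi_latopp.
have r2 m : RI (latopp m) = RI m.
  by congr cube_int; apply/funext => y; rewrite phi_latopp.
have r3 m : IR (latopp m) = - IR m.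
  rewrite -mulN1r -cube_intZ; last exact: contM.
  by congr cube_int; apply/funext => y; rewrite phi_latopp mulN1r -mulNr.
have r4 m : II (latopp m) = - II m.
  rewrite -mulN1r -cube_intZ; last exact: contM.
  by congr cube_int; apply/funext => y; rewrite phi_latopp mulN1r -mulNr.
have z1 m : RR m = 0 by have := e1 m; have := e1 (latopp m); rewrite r1 r4; lra.
have z2 m : II m = 0 by have := e1 m; have := e1 (latopp m); rewrite r1 r4; lra.
have z3 m : RI m = 0 by have := e2 m; have := e2 (latopp m); rewrite r2 r3; lra.
have z4 m : IR m = 0 by have := e2 m; have := e2 (latopp m); rewrite r2 r3; lra.
apply: complexP; apply: (@trig_orthogonal_eq0 (fun y => _ (v y))) => //.
- by move=> x i; rewrite per.
- move=> c m.
  have -> : (fun y => cos (c + 2 * pi * dotp m y) * complex.Re (v y)) =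
    (fun y => cos c * (complex.Re (phi m y) * complex.Re (v y)) +
              (- sin c) * (complex.Im (phi m y) * complex.Re (v y))).
    by apply/funext => y; rewrite cos_dotpC; ring.
  rewrite cube_int_lin; [|exact: contM|by apply/contZ/contM].
  by rewrite cube_intZ; [rewrite -/(RR m) -/(IR m) z1 z4; ring | exact: contM].
- by move=> x i; rewrite per.
- move=> c m.
  have -> : (fun y => cos (c + 2 * pi * dotp m y) * complex.Im (v y)) =
    (fun y => cos c * (complex.Re (phi m y) * complex.Im (v y)) +
              (- sin c) * (complex.Im (phi m y) * complex.Im (v y))).
    by apply/funext => y; rewrite cos_dotpC; ring.
  rewrite cube_int_lin; [|exact: contM|by apply/contZ/contM].
  by rewrite cube_intZ; [rewrite -/(RI m) -/(II m) z2 z3; ring | exact: contM].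
Qed.

Lemma fourier_inversion u x0 : ccont u -> torus_periodic u -> abs_summable (fourier u) ->
  in_cube x0 -> u x0 = fser (fourier u) x0.
Proof.
move=> cu per hs hx0; apply/eqP; rewrite -subr_eq0 addrC -mulN1r; apply/eqP.
have cs := ccont_fser hs.
apply: (@fourier_eq0 (fun x => -1 * fser (fourier u) x + u x)) => //.
- by apply: ccontD => //; apply: ccontM => //; exact: ccont_cst.
- by move=> x i; rewrite per fser_periodic.
move=> m.
have -> : fourier (fun x => -1 * fser (fourier u) x + u x) m =
    cube_intC (fun x => -1 * (fser (fourier u) x * cconj (phi m x)) + u x * cconj (phi m x)).
  by rewrite -[LHS]/(cube_intC _); congr cube_intC; apply/funext => x; ring.
have cJ := ccont_conj (@ccont_phi R d m).
rewrite cube_intC_lin; [|exact: ccontM|exact: ccontM].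
rewrite -[cube_intC (fun x => u x * _)]/(fourier u m).
by rewrite -[cube_intC _]/(fourier (fser (fourier u)) m) fourier_fser // mulN1r addNr.
Qed.

End Inversion.

(** * Aliasing on the grid and the interpolant *)

Section LatticeShift.
Variables d q : nat.
Implicit Types m b : lat d.

Lemma latshift_latshift m b b' : latshift q (latshift q m b) b' = latshift q m (latadd b' b).
Proof. by apply/funext => i; rewrite /latshift /latadd; ring. Qed.

Lemma latshift_rep m : exists (k : Jq d q) b, m = latshift q (zlat k) b.
Proof.
have n0 : (0 < 2 ^ q)%N by rewrite expn_gt0.
have lt i : (absz (m i %% (2 ^ q)%N)%Z < 2 ^ q)%N.
  have := ltz_pmod (m i) (d := (2 ^ q)%N%:Z).
  by have := modz_ge0 (m i) (d := (2 ^ q)%N%:Z); lia.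
exists [ffun i => Ordinal (lt i)], (fun i => (m i %/ (2 ^ q)%N)%Z); apply/funext => i.
rewrite /latshift /zlat ffunE /=.
have := modz_ge0 (m i) (d := (2 ^ q)%N%:Z); have := divz_eq (m i) (2 ^ q)%N; lia.
Qed.

End LatticeShift.

Section Aliasing.
Variables (R : realType) (d q : nat).
Implicit Types (m b : lat d) (j k l : Jq d q) (x : pt R d).

Let n := (2 ^ q)%N.
Let n0 : (0 < n)%N. Proof. by rewrite expn_gt0. Qed.
Let nR0 : (n%:R : R) != 0. Proof. by rewrite pnatr_eq0 -lt0n. Qed.

Local Notation grid j := (gridpt R j).

Lemma gridpt_in_cube j : in_cube (grid j).
Proof.
move=> i; rewrite mxE -/n divr_ge0 //= ler_pdivrMr ?ltr0n // mul1r ler_nat.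
exact: ltnW.
Qed.

(** At x_j = j / 2^q the shift by 2^q b changes the phase by 2 pi times the integer <b, j>. *)
Lemma phi_latshift_grid m b j : phi (latshift q m b) (grid j) = phi m (grid j).
Proof.
rewrite /phi.
have -> : dotp (latshift q m b) (grid j) =
    dotp m (grid j) + (\sum_i b i * (j i : nat)%:Z)%:~R.
  rewrite rmorph_sum -big_split /=; apply: eq_bigr => i _.
  rewrite !mxE /latshift rmorphD !rmorphM /= -!pmulrn -/n mulrDl; congr (_ + _).
  by field.
by rewrite mulrDr cosD2piz sinD2piz.
Qed.

Lemma cos2pi_lt1 (s : R) : 0 < s < 1 -> cos (2 * pi * s) != 1.
Proof.
move=> /andP[s0 s1]; have pi0 := pi_gt0 R.
have h : 0 < sin (pi * s) by apply: sin_gt0_pi; apply/andP; split; nra.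
have -> : 2 * pi * s = (pi * s) *+ 2 by ring.
by rewrite cos_mulr2n cos2sin2; apply/eqP; nra.
Qed.

(** Advancing a coordinate i0 with m_i0 nonzero cyclically permutes the grid and multiplies each
    term by w = exp(2 pi i m_i0 / n). As 0 < |m_i0| < n, w is not 1 and the sum vanishes. *)
Lemma sum_phi_grid m : (forall i, `|m i| < n)%N ->
  \sum_(j : Jq d q) phi m (grid j) = if latzero m then (n%:R ^+ d)%:C else 0.
Proof.
move=> mn; case: ifPn => [/forallP mz|].
  rewrite (eq_bigr (fun _ => 1)) => [|j _].
    by rewrite sumr_const card_ffun !card_ord -natrX rmorph_nat.
  have -> : phi m (grid j) = phi (fun=> 0) (grid j).
    by congr phi; apply/funext => i; exact/eqP.
  by rewrite /phi /dotp big1 ?mulr0 ?cos0 ?sin0 // => i _; rewrite mul0r.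
rewrite /latzero negb_forall => /existsP[i0 mi0].
pose s j : Jq d q := [ffun i => if i == i0 then ordS (j i) else j i].
have sinj : injective s.
  move=> j k /ffunP h; apply/ffunP => i; have := h i; rewrite !ffunE.
  by case: eqP => // _ /ordS_inj.
pose w : R[i] := Complex (cos (2 * pi * ((m i0)%:~R / n%:R))) (sin (2 * pi * ((m i0)%:~R / n%:R))).
have step j : phi m (grid (s j)) = w * phi m (grid j).
  (* Wrapping from n - 1 to 0 lowers the grid coordinate by 1, which changes the phase by a whole
     number of turns. *)
  pose z : int := if ((j i0).+1 == n)%N then - m i0 else 0.
  have -> : phi m (grid (s j)) = Complex
      (cos (2 * pi * (dotp m (grid j) + (m i0)%:~R / n%:R) + 2 * pi * z%:~R))
      (sin (2 * pi * (dotp m (grid j) + (m i0)%:~R / n%:R) + 2 * pi * z%:~R)).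
    rewrite /phi -!mulrDr.
    have -> // : dotp m (grid (s j)) = dotp m (grid j) + (m i0)%:~R / n%:R + z%:~R.
    rewrite /dotp (bigD1 i0) //= [in RHS](bigD1 i0) //=.
    rewrite [X in _ + X](eq_bigr (fun i => (m i)%:~R * grid j ord0 i)); last first.
      by move=> i /negbTE ii; rewrite !mxE ffunE ii.
    rewrite !mxE ffunE eqxx /= -/n /z.
    have := ltn_ord (j i0); rewrite -/n leq_eqVlt => /orP[/eqP e|lt].
      have jE : (j i0 : nat)%:R = n%:R - 1 :> R by rewrite -e -natr1 addrK.
      by rewrite e eqxx modnn rmorphN /= jE; field.
    by rewrite (ltn_eqF lt) modn_small // -natr1; field.
  rewrite cosD2piz sinD2piz /w /phi; apply: complexP; rewrite ?Re_mul ?Im_mul /= mulrDr ?cosD ?sinD; ring.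
have w1 : w != 1.
  suff : complex.Re w != 1 by apply: contraNneq => ->.
  rewrite /w /=; have [mp|mp] := ltP 0 (m i0).
    apply: cos2pi_lt1; rewrite divr_gt0 ?ltr0z ?ltr0n //= ltr_pdivrMr ?ltr0n // mul1r.
    by rewrite -[n%:R]/(n%:Z%:~R) ltr_int; have := mn i0; lia.
  rewrite -cosN -mulrN -mulNr; apply: cos2pi_lt1.
  rewrite -rmorphN /= divr_gt0 ?ltr0z ?ltr0n //=; last by lia.
  rewrite ltr_pdivrMr ?ltr0n // mul1r.
  by rewrite -[n%:R]/(n%:Z%:~R) ltr_int; have := mn i0; lia.
apply/eqP; have /eqP : \sum_(j : Jq d q) phi m (grid j) = w * \sum_(j : Jq d q) phi m (grid j).
  by rewrite [LHS](reindex_inj sinj) mulr_sumr; apply: eq_bigr => j _; exact: step.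
rewrite -subr_eq0 -{1}[\sum_j _]mul1r -mulrBl mulf_eq0 subr_eq0 eq_sym.
by rewrite (negbTE w1).
Qed.

Lemma phi_grid_orthogonal k l :
  \sum_(j : Jq d q) cconj (phi (zlat k) (grid j)) * phi (zlat l) (grid j) =
  if k == l then (n%:R ^+ d)%:C else 0.
Proof.
rewrite (eq_bigr (fun j => phi (latadd (latopp (zlat k)) (zlat l)) (grid j))); last first.
  by move=> j _; rewrite phi_latadd phi_latopp.
rewrite sum_phi_grid; last first.
  move=> i; rewrite /latadd /latopp /zlat; have := ltn_ord (k i); have := ltn_ord (l i).
  by rewrite -/n; lia.
congr (if _ then _ else _); apply/forallP/eqP => [h|-> i]; last by rewrite /latadd /latopp addNr.
by apply/ffunP => i; apply/val_inj; have := h i; rewrite /latadd /latopp /zlat /=; lia.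
Qed.

End Aliasing.

(** * The kernel matrix and the Fourier coefficients of the interpolant *)

Section Kernel.
Variables (R : realType) (d q : nat) (t : R).
Hypothesis ht : d%:R / 2 < t.
Implicit Types (m b : lat d) (j k l : Jq d q) (x y : pt R d).

Let c0 : R := powR (4 * pi ^+ 2) (- t).

Lemma c0_gt0 : 0 < c0.
Proof. by apply: powR_gt0; rewrite mulr_gt0 // exprn_gt0 // pi_gt0. Qed.

Definition kcoef y m : R[i] := (c0 * kap t m)%:C * cconj (phi m y).

Lemma Kt_fser x y : Kt t x y = fser (kcoef y) x.
Proof.
rewrite /Kt /fser; congr zsum; apply/funext => m; rewrite /kcoef /kap.
case: ifP => _; first by rewrite mulr0 !mul0r.
rewrite powRM ?norm2_ge0 //; last by rewrite mulr_ge0 // sqr_ge0.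
by rewrite -/c0; ring.
Qed.

Lemma kap_box_bounded (s : lat d -> lat d) : injective s -> box_bounded (kap t \o s).
Proof. by move=> injs; apply: bounded_comp_inj (kap_bounded ht) => // m; exact: kap_ge0. Qed.

Lemma abs_summable_c0kap : abs_summable (fun m : lat d => (c0 * kap t m)%:C).
Proof.
have [B hB] := kap_bounded ht; exists (c0 * B) => N.
apply: (@le_trans _ _ (c0 * boxsumR (kap t) N)); last by rewrite ler_wpM2l // ltW ?c0_gt0.
rewrite /boxsumR mulr_sumr; apply: ler_sum => k _.
by rewrite cabs_real // mulr_ge0 ?kap_ge0 // ltW ?c0_gt0.
Qed.

Lemma abs_summable_kcoef y : abs_summable (kcoef y).
Proof.
apply: abs_summable_le abs_summable_c0kap => m.
by rewrite /kcoef cabsM cabs_conj cabs_phi mulr1.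
Qed.

Lemma zsum_real (f : lat d -> R) : zsum (fun m => (f m)%:C) = (zsumR f)%:C.
Proof.
apply: complexP => //=; rewrite /zsumR (_ : boxsumR _ = cst 0) ?lim_cst //.
by apply/funext => N; rewrite /boxsumR big1.
Qed.

Definition Lam m : R := zsumR (fun b => c0 * kap t (latshift q m b)).

Lemma dominated_kap m :
  dominated (fun b => kap t (latshift q m b)) (fun b => kap t (latshift q m b)).
Proof.
split; last exact: kap_box_bounded (@latshift_inj d q m).
by move=> b'; rewrite ger0_norm ?kap_ge0.
Qed.

Lemma kap_sum_shift m b : zsumR (fun b' => kap t (latshift q (latshift q m b) b')) =
  zsumR (fun b' => kap t (latshift q m b')).
Proof.
rewrite -(zsum_shift b (dominated_kap m)); congr zsumR; apply/funext => b'.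
by rewrite latshift_latshift.
Qed.

(** The value 0 of [kap] at the origin accounts for both cases of [Mqt]: the class of 0 contains the
    origin and loses that one term after a shift to the representative 0, while no other class meets
    the origin. *)
Lemma kap_sum_Mqt m : zsumR (fun b => kap t (latshift q m b)) = Mqt q t m.
Proof.
rewrite /Mqt; case: ifPn => [/forallP mq|mq].
  have -> : m = latshift q (fun=> 0) (fun i => (m i %/ (2 ^ q)%:Z)%Z).
    by apply/funext => i; rewrite /latshift add0r mulrC divzK.
  rewrite kap_sum_shift; congr zsumR; apply/funext => b; rewrite /kap.
  congr (if _ then _ else _); apply: eq_forallb => i.
  by rewrite /latshift add0r mulf_eq0 (_ : _ == 0 = false) //; apply/negbTE; rewrite eqz_nat expn_eq0.
congr zsumR; apply/funext => b; rewrite /kap; case: ifP => // /forallP h.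
case/negP: mq; apply/forallP => i; have /eqP := h i.
rewrite /latshift => e; apply/dvdzP; exists (- b i); move: e; lia.
Qed.

Lemma zsumRZ (a : R) (f : lat d -> R) : dominated f f ->
  zsumR (fun b => a * f b) = a * zsumR f.
Proof.
move=> h; have c := boxsum_cvg h.
rewrite {1}/zsumR (_ : boxsumR _ = (fun N => a * boxsumR f N)); last first.
  by apply/funext => N; rewrite /boxsumR mulr_sumr.
by apply: cvg_lim => //; apply: cvgMr.
Qed.

Lemma LamE m : Lam m = c0 * Mqt q t m.
Proof. by rewrite /Lam zsumRZ ?kap_sum_Mqt //; exact: dominated_kap. Qed.

Lemma Lam_gt0 k : (0 < d)%N -> 0 < Lam (zlat k).
Proof.
move=> d0; rewrite LamE mulr_gt0 ?c0_gt0 // -kap_sum_Mqt.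
have [h1 h2] := dominated_kap (zlat k).
have h0 m : 0 <= kap t (latshift q (zlat k) m) by exact: kap_ge0.
apply: lt_le_trans (boxsum_le_zsum 1 h0 h2).
(* The shift b = (1,...,1) makes k + 2^q b nonzero for every residue k >= 0, so the box of radius 1
   has a positive term. *)
have [b hb] := @mem_box d 1 (fun=> 1) (fun=> isT).
rewrite /boxsumR (bigD1 b) //= ltr_wpDr ?sumr_ge0 // hb.
rewrite /kap ifN; last first.
  apply/forallPn; exists (Ordinal d0); rewrite /latshift /zlat mulr1.
  by have : (0 < 2 ^ q)%N by [rewrite expn_gt0]; lia.
apply: powR_gt0; apply: (@lt_le_trans _ _ _ _ _ _ (norm2_ge R (latshift q (zlat k) (fun=> 1)) (Ordinal d0))).
rewrite /latshift /zlat mulr1 exprn_gt0 // ltr0z.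
by have : (0 < 2 ^ q)%N by [rewrite expn_gt0]; lia.
Qed.

Lemma Lam_latshift m b : Lam (latshift q m b) = Lam m.
Proof. by rewrite !LamE -!kap_sum_Mqt kap_sum_shift. Qed.

Lemma Tq_latshift (g : lat d -> R[i]) m b : abs_summable g ->
  Tq q g (latshift q m b) = Tq q g m.
Proof.
move=> hg; have h := abs_summable_comp_inj (@latshift_inj d q m) hg.
by rewrite /Tq -(czsum_shift b h); congr zsum; apply/funext => b'; rewrite latshift_latshift.
Qed.

(** Within one class the characters agree at a grid point and factor out, leaving the periodized
    coefficients. *)
Lemma fser_grid (g : lat d -> R[i]) (j : Jq d q) : abs_summable g ->
  fser g (gridpt R j) = \sum_(k : Jq d q) phi (zlat k) (gridpt R j) * Tq q g (zlat k).
Proof.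
move=> hg; rewrite /fser (czsum_regroup q (abs_summable_phi _ hg)); apply: eq_bigr => k _.
have h := abs_summable_comp_inj (@latshift_inj d q (zlat k)) hg.
rewrite /Tq -zsum_scale //; congr zsum; apply/funext => b.
by rewrite phi_latshift_grid mulrC.
Qed.

Lemma Tq_kcoef (j k : Jq d q) : Tq q (kcoef (gridpt R j)) (zlat k) =
  (Lam (zlat k))%:C * cconj (phi (zlat k) (gridpt R j)).
Proof.
rewrite mulrC -zsum_real -zsum_scale; last first.
  exact: (abs_summable_comp_inj (@latshift_inj d q (zlat k)) abs_summable_c0kap).
congr zsum; apply/funext => b.
by rewrite /kcoef phi_latshift_grid mulrC.
Qed.

Lemma Kt_grid (i j : Jq d q) : Kt t (gridpt R i) (gridpt R j) = \sum_(k : Jq d q)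
  phi (zlat k) (gridpt R i) * ((Lam (zlat k))%:C * cconj (phi (zlat k) (gridpt R j))).
Proof.
rewrite Kt_fser fser_grid; last exact: abs_summable_kcoef.
by apply: eq_bigr => k _; rewrite Tq_kcoef.
Qed.

Lemma real_complex_eq0 (x : R) : (x%:C == 0 :> R[i]) = (x == 0).
Proof. by rewrite eq_complex /= eqxx andbT. Qed.

Let Phi : 'M[R[i]]_(nJ d q) := \matrix_(a, b) phi (zlat (enum_val b)) (gridJ R a).
Let PhiH : 'M[R[i]]_(nJ d q) := \matrix_(b, a) cconj (phi (zlat (enum_val b)) (gridJ R a)).
Let D : 'M[R[i]]_(nJ d q) := diag_mx (\row_b (Lam (zlat (enum_val b)))%:C).
Let s : R[i] := (((2 ^ q)%:R : R) ^+ d)%:C.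

Lemma sum_enum_val (F : Jq d q -> R[i]) : \sum_(a < nJ d q) F (enum_val a) = \sum_j F j.
Proof. by rewrite [RHS]big_enum_val. Qed.

Lemma PhiH_Phi : PhiH *m Phi = s%:M.
Proof.
apply/matrixP => a b; rewrite !mxE.
under eq_bigr do rewrite !mxE /gridJ.
rewrite (sum_enum_val (fun j => cconj (phi (zlat (enum_val a)) (gridpt R j)) *
   phi (zlat (enum_val b)) (gridpt R j))) phi_grid_orthogonal.
by rewrite (inj_eq enum_val_inj); case: eqP.
Qed.

Lemma Kmat_factor : Kmat d t q = Phi *m D *m PhiH.
Proof.
apply/matrixP => a b; rewrite !mxE /gridJ Kt_grid -sum_enum_val; apply: eq_bigr => c _.
rewrite mul_mx_diag !mxE /gridJ.
by rewrite mulrA.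
Qed.

Lemma s_neq0 : s != 0.
Proof. by rewrite /s real_complex_eq0 expf_neq0 // pnatr_eq0 expn_eq0. Qed.

Lemma Phi_units : Phi \in unitmx /\ PhiH \in unitmx.
Proof.
have h : (s^-1 *: PhiH) *m Phi = 1%:M.
  by rewrite -scalemxAl PhiH_Phi scale_scalar_mx mulVf // s_neq0.
have [h1 h2] := mulmx1_unit h; split => //.
by move: h1; rewrite unitmxZ // unitfE invr_neq0 // s_neq0.
Qed.

Lemma Kmat_unit : (0 < d)%N -> Kmat d t q \in unitmx.
Proof.
move=> d0; have [h1 h2] := Phi_units.
rewrite Kmat_factor !unitmx_mul h1 h2 andbT /= unitmxE det_diag unitfE.
apply/prodf_neq0 => b _; rewrite mxE real_complex_eq0 gt_eqF //.
exact: Lam_gt0.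
Qed.

Variable u : pt R d -> R[i].
Hypothesis cu : ccont u.
Hypothesis hper : torus_periodic u.
Hypothesis hsum : abs_summable (fourier u).

Let c := invmx (Kmat d t q) *m \col_(b < nJ d q) u (gridJ R b).

(** The interpolation equations read Phi D Phi^* c = Phi tau; cancelling the invertible Phi leaves a
    diagonal system. *)
Lemma interp_coef k : (0 < d)%N ->
  (Lam (zlat k))%:C * \sum_a cconj (phi (zlat k) (gridJ R a)) * c a ord0 =
  Tq q (fourier u) (zlat k).
Proof.
move=> d0; have [h1 h2] := Phi_units.
pose tau : 'cV[R[i]]_(nJ d q) := \col_b Tq q (fourier u) (zlat (enum_val b)).
have uE : \col_(b < nJ d q) u (gridJ R b) = Phi *m tau.
  apply/colP => a; rewrite !mxE /gridJ.
  rewrite fourier_inversion //; last exact: gridpt_in_cube.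
  rewrite fser_grid // -sum_enum_val; apply: eq_bigr => b _.
  by rewrite !mxE.
have E : D *m (PhiH *m c) = tau.
  apply: (can_inj (mulKmx h1)).
  by rewrite -uE /c !mulmxA -Kmat_factor mulmxV ?mul1mx // Kmat_unit.
have := congr1 (fun A : 'cV[R[i]]_(nJ d q) => A (enum_rank k) ord0) E.
rewrite mul_diag_mx !mxE enum_rankK => <-; congr (_ * _).
by apply: eq_bigr => a _; rewrite !mxE enum_rankK.
Qed.

(** The interpolant is a finite combination of kernel sections, each an absolutely convergent
    Fourier series whose coefficients are recovered by [fourier_fser]. *)
Lemma fourier_uinterp m : fourier (uinterp t q u) m =
  (c0 * kap t m)%:C * \sum_a cconj (phi m (gridJ R a)) * c a ord0.
Proof.
rewrite -[LHS]/(cube_intC (fun x => uinterp t q u x * cconj (phi m x))).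
have cJ := ccont_conj (@ccont_phi R d m).
have -> : (fun x => uinterp t q u x * cconj (phi m x)) =
    (fun x => \sum_a c a ord0 * (fser (kcoef (gridJ R a)) x * cconj (phi m x))).
  apply/funext => x; rewrite /uinterp /= mulr_suml; apply: eq_bigr => a _.
  by rewrite Kt_fser -/c; ring.
rewrite cube_intC_sum; last first.
  by move=> a; apply: ccontM => //; apply: ccont_fser; exact: abs_summable_kcoef.
rewrite mulr_sumr; apply: eq_bigr => a _.
rewrite -[cube_intC _]/(fourier (fser (kcoef (gridJ R a))) m) fourier_fser; last first.
  exact: abs_summable_kcoef.
by rewrite /kcoef; ring.
Qed.

Lemma fourier_uinterp_formula m : ~~ latzero m ->
  fourier (uinterp t q u) m =
  (powR (norm2 R m) (- t))%:C * Tq q (fourier u) m / (Mqt q t m)%:C.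
Proof.
move=> m0; have d0 : (0 < d)%N.
  by move: m0; rewrite /latzero negb_forall => /existsP[i _]; apply: leq_ltn_trans (ltn_ord i).
have [k [b hm]] := latshift_rep q m.
have := interp_coef k d0.
have -> : Lam (zlat k) = c0 * Mqt q t m by rewrite -LamE [in RHS]hm Lam_latshift.
have -> : Tq q (fourier u) (zlat k) = Tq q (fourier u) m by rewrite hm Tq_latshift.
move=> <-; rewrite fourier_uinterp.
have -> : \sum_a cconj (phi m (gridJ R a)) * c a ord0 =
    \sum_a cconj (phi (zlat k) (gridJ R a)) * c a ord0.
  by apply: eq_bigr => a _; rewrite hm /gridJ phi_latshift_grid.
(* Nonvanishing at m is inherited from positivity of L at its residue k, as L is constant on
   classes. *)
have M0 : (Mqt q t m)%:C != 0 :> R[i].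
  have := Lam_gt0 k d0; rewrite -(Lam_latshift _ b) -hm LamE pmulr_rgt0 ?c0_gt0 //.
  by move=> h; rewrite real_complex_eq0 gt_eqF.
rewrite {1}/kap (negbTE m0) !rmorphM /=.
by field.
Qed.

End Kernel.

Theorem theorem2p2 (R : realType) (d : nat) (t : R) (q : nat)
  (u : pt R d -> R[i])
  (ht : (d%:R / 2 < t)%R)
  (hcontRe : continuous (fun x => complex.Re (u x)))
  (hcontIm : continuous (fun x => complex.Im (u x)))
  (hper : torus_periodic u)
  (hmean : fourier u (fun _ => 0%Z) = 0)
  (hsum : abs_summable (fourier u)) :
  fourier (uinterp t q u) (fun _ => 0%Z) = 0 /\
  forall m : lat d, ~~ latzero m ->
    fourier (uinterp t q u) m =
      (powR (norm2 R m) (- t))%:C * Tq q (fourier u) m / (Mqt q t m)%:C.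
Proof.
split; last by move=> m; exact: fourier_uinterp_formula.
(* The kernel has no constant mode: its weight at the origin is 0. *)
rewrite fourier_uinterp // /kap (_ : latzero _ = true) ?mulr0 ?mul0r //.
exact/forallP.
Qed.
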